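(* Let $G(V,E)$ be a graph on $n$ vertices, let $k\ge 1$, and let $G^{(1)},\ldots,G^{(k)}$ be a random $k$-partition of $G$. For any $\varepsilon\in(0,1)$, set $\lambda:=\Theta\big((\varepsilon/\log n)^2\big)$ and $\beta:=\Theta(\varepsilon^{-6}\log^{7} n)$ (for suitable absolute constants in the $\Theta$-notation). Then the algorithm that, on input $G^{(i)}$, outputs an arbitrary $\mathrm{EDCS}(G^{(i)},\beta,(1-\lambda)\beta)$ is a $(3/2+\varepsilon)$-approximation randomized composable coreset of size $O(n\cdot\beta)$ for the maximum matching problem. That is, for arbitrary choices of EDCSs $C^{(i)}$ of $G^{(i)}$ with these parameters, with high probability (over the random $k$-partition) the graph $C^{(1)}\cup\cdots\cup C^{(k)}$ contains a matching of size at least $\mathrm{MM}(G)/(3/2+\varepsilon)$, and each $C^{(i)}$ has $O(n\beta)$ edges.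
   Context: For a graph $G$, $\mathrm{MM}(G)$ denotes the size of a maximum matching of $G$, and $\deg_H(v)$ the degree of $v$ in a subgraph $H$. A random $k$-partition of $G(V,E)$ is obtained by sending each edge of $E$ independently to one of $k$ sets $E^{(1)},\ldots,E^{(k)}$ chosen uniformly at random, and letting $G^{(i)}=(V,E^{(i)})$. For parameters $\beta>\beta^-$, an edge degree constrained subgraph $\mathrm{EDCS}(G,\beta,\beta^-)$ is a subgraph $H$ of $G$ such that (P1) every edge $(u,v)\in H$ satisfies $\deg_H(u)+\deg_H(v)\le\beta$, and (P2) every edge $(u,v)\in G\setminus H$ satisfies $\deg_H(u)+\deg_H(v)\ge\beta^-$. An algorithm ALG mapping graphs to subgraphs is an $\alpha$-approximation randomized composable coreset for maximum matching if for any graph $G$ and a random $k$-partition of $G$, the maximum matching of $\mathrm{ALG}(G^{(1)})\cup\cdots\cup\mathrm{ALG}(G^{(k)})$ has size at least $\mathrm{MM}(G)/\alpha$ with high probability; its size is the number of edges of the returned subgraph. ''With high probability'' means with probability $1-1/\mathrm{poly}(n)$. *)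

(* Defs.v *)
From HB Require Import structures.
From mathcomp Require Import all_boot all_order all_algebra.
From mathcomp Require Import reals exp.

Set Implicit Arguments.
Unset Strict Implicit.
Unset Printing Implicit Defensive.

Import Order.TTheory GRing.Theory Num.Theory.
Local Open Scope ring_scope.

(* A graph on the vertex set V is given by its edge set, an edge being the
   unordered pair of its endpoints; all subgraphs keep the vertex set V. *)
Definition simple_graph (V : finType) (G : {set {set V}}) : bool :=
  [forall e in G, #|e| == 2%N].

Definition deg (V : finType) (H : {set {set V}}) (v : V) : nat :=
  #|[set e in H | v \in e]|.

Definition matching (V : finType) (G M : {set {set V}}) : bool :=
  (M \subset G) && trivIset M.

Definition MM (V : finType) (G : {set {set V}}) : nat :=
  (\max_(M : {set {set V}} | matching G M) #|M|)%N.

Definition edcs (R : realType) (V : finType) (beta beta' : R)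
    (G H : {set {set V}}) : bool :=
  [&& H \subset G,
      [forall u, forall v, ([set u; v] \in H) ==>
         ((deg H u + deg H v)%N%:R <= beta)]
    & [forall u, forall v, ([set u; v] \in G :\: H) ==>
         (beta' <= (deg H u + deg H v)%N%:R)]].

Definition kassign (V : finType) (k : nat) (G : {set {set V}}) :=
  {ffun {e : {set V} | e \in G} -> 'I_k}.

Definition part (V : finType) (k : nat) (G : {set {set V}})
    (f : kassign k G) (i : 'I_k) : {set {set V}} :=
  [set val e | e : {e : {set V} | e \in G} & f e == i].

(* Probability of the event A for a random k-partition: the parts of the edges
   are independent, each uniform over the k indices, so that the law is the
   product over the edges of the weights 1/k. *)
Definition Pr_kpartition (R : realType) (V : finType) (k : nat)
    (G : {set {set V}}) (A : pred (kassign k G)) : R :=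
  \sum_(f : kassign k G | A f)
    \prod_(e : {e : {set V} | e \in G}) (k%:R)^-1.

(* ALG G C means that C is a possible output of the algorithm on input G.  The
   outputs on the k parts are chosen adversarially, with full knowledge of the
   partition. The first conjunct (some output exists on every input) keeps the
   last one from being vacuous. *)
Definition randomized_composable_coreset (R : realType) (V : finType) (k : nat)
    (alpha delta : R) (ALG : rel {set {set V}}) : Prop :=
  [/\ forall G, simple_graph G -> exists C, ALG G C,
      forall G C, simple_graph G -> ALG G C -> C \subset G
    & forall G, simple_graph G ->
        1 - delta <=
        Pr_kpartition R (fun f : kassign k G =>
          [forall C : {ffun 'I_k -> {set {set V}}},
             [forall i, ALG (part f i) (C i)] ==>
             ((MM G)%:R / alpha <= (MM (\bigcup_i C i))%:R :> R)])].

Definition coreset_size_le (R : realType) (V : finType)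
    (ALG : rel {set {set V}}) (s : R) : Prop :=
  forall G C, simple_graph G -> ALG G C -> #|C|%:R <= s.

(* Main.v *)
Require Import Defs.
From HB Require Import structures.
From mathcomp Require Import all_boot all_order all_algebra.
From mathcomp Require Import reals sequences exp ring lra zify.

Set Implicit Arguments.
Unset Strict Implicit.
Unset Printing Implicit Defensive.

Import Order.TTheory GRing.Theory Num.Theory.
Local Open Scope ring_scope.

(* Let H be a minimiser of sum_v deg(v)^2 - 2 k beta |H| over the subgraphs of
   G: it is an EDCS of G of degree bound about k beta, and it does not depend on
   the random partition.  By Chernoff bounds deg_{H cap G_i}(v) is close to
   deg_H(v) / k for all v and i, so that H cap G_i is almost an EDCS of G_i.

   Two EDCSs A, B of one graph have close degrees: put x = deg_A - deg_B.  An
   edge of A - B at a vertex with x >= a leads to a vertex with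
   x <= -(a - 2 eta), where the degree in B - A exceeds that in A - B by
   a - 2 eta; so the number of edges of the difference at {|x| >= a} grows
   geometrically as a decreases, and the range of x is bounded.  This applies to
   C_i and H cap G_i for all adversarial C_i at once, and yields
   deg_{C_i}(v) ~ deg_H(v) / k; hence the union C of the C_i is an EDCS of G with
   relative slack O(eps).

   For the ratio 3/2, a random bipartition in which all edges of a maximum
   matching M of G cross halves all degrees of C up to a small error.  Take a
   Konig vertex cover K of the crossing part of C: the edges of M that avoid K
   have large degree in C, all of which goes into K, and the upper bound on the
   edge degrees then gives at most about |K| / 2 such edges. *)

(** * Degrees, matchings and EDCSs of simple graphs *)

Section Graphs.
Variable V : finType.
Implicit Types (G H M A B C : {set {set V}}) (u v : V).

Lemma simple_graphS G H : H \subset G -> simple_graph G -> simple_graph H.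
Proof.
move=> sHG /forall_inP sG; apply/forall_inP => e eH.
exact: sG (subsetP sHG _ eH).
Qed.

Lemma simple_edgeP G e v : simple_graph G -> e \in G -> v \in e ->
  exists2 u, u != v & e = [set v; u].
Proof.
move=> /forall_inP sG /sG /cards2P [a] [b] [ab ->].
rewrite !inE => /orP [] /eqP ->.
- by exists b => //; rewrite eq_sym.
- by exists a => //; rewrite setUC.
Qed.

Lemma simple_edge_ends G e : simple_graph G -> e \in G ->
  exists u, exists2 v, u != v & e = [set u; v].
Proof.
move=> sG eG; have /forall_inP /(_ _ eG) /cards2P [a [b [ab ->]]] := sG.
by exists a, b.
Qed.

Lemma simple_edge_neq G u v : simple_graph G -> [set u; v] \in G -> u != v.
Proof. by move=> /forall_inP sG /sG; rewrite cards2; case: (u != v). Qed.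

Lemma eq_set2l u v w : u != v -> [set v; u] = [set v; w] -> u = w.
Proof.
move=> uv E; have : u \in [set v; w] by rewrite -E !inE eqxx orbT.
by rewrite !inE (negbTE uv) /= => /eqP.
Qed.

Lemma deg_nbr H v : simple_graph H ->
  deg H v = #|[set u | [set v; u] \in H]|.
Proof.
move=> sH; rewrite /deg.
rewrite -[RHS](card_in_imset (f := fun u => [set v; u])); last first.
  move=> u w; rewrite !inE => uH _ E; apply: eq_set2l E.
  by rewrite eq_sym; apply: simple_edge_neq uH.
apply: eq_card => e; rewrite inE; apply/andP/imsetP => [[eH ve]|[u]].
  have [u _ ee] := simple_edgeP sH eH ve.
  by exists u => //; rewrite inE -ee.
by rewrite inE => uH ->; rewrite uH !inE eqxx.
Qed.

Lemma deg_sum_nbr H v : simple_graph H ->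
  deg H v = (\sum_u ([set v; u] \in H))%N.
Proof.
move=> sH; rewrite deg_nbr // -sum1_card big_mkcond /=.
by apply: eq_bigr => u _; rewrite inE; case: ifP.
Qed.

Lemma deg_sum_edges H v : deg H v = (\sum_(e in H) (v \in e))%N.
Proof.
rewrite /deg -sum1_card big_mkcond [RHS]big_mkcond /=.
by apply: eq_bigr => e _; rewrite inE; case: (e \in H); case: (v \in e).
Qed.

Lemma deg_le_card H v : simple_graph H -> (deg H v <= #|V|)%N.
Proof. by move=> sH; rewrite deg_nbr // max_card. Qed.

Lemma degS G H v : H \subset G -> (deg H v <= deg G v)%N.
Proof.
move=> sHG; apply/subset_leq_card/subsetP => e; rewrite !inE.
by case/andP => /(subsetP sHG) -> ->.
Qed.

Lemma deg_setD A B v : (deg (A :\: B) v + deg (A :&: B) v = deg A v)%N.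
Proof.
rewrite /deg -(cardsID B [set e in A | v \in e]) addnC; congr (_ + _)%N;
  by apply: eq_card => e; rewrite !inE; case: (e \in A); case: (e \in B);
     case: (v \in e).
Qed.

Lemma deg_gt0 H v : simple_graph H -> (0 < deg H v)%N ->
  exists u, [set v; u] \in H.
Proof.
move=> sH /card_gt0P [e]; rewrite inE => /andP [eH ve].
by have [u _ ee] := simple_edgeP sH eH ve; exists u; rewrite -ee.
Qed.

Lemma deg_setU1 H e v : e \notin H -> deg (e |: H) v = ((v \in e) + deg H v)%N.
Proof. by move=> eH; rewrite !deg_sum_edges big_setU1. Qed.

Lemma deg_setD1 H e v : e \in H -> deg H v = ((v \in e) + deg (H :\ e) v)%N.
Proof. by move=> eH; rewrite !deg_sum_edges (big_setD1 e). Qed.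

Lemma deg_bigcup (I : finType) (C : I -> {set {set V}}) v :
  (forall i j, i != j -> [disjoint C i & C j]) ->
  deg (\bigcup_i C i) v = (\sum_i deg (C i) v)%N.
Proof.
move=> disj; rewrite deg_sum_edges.
under [RHS]eq_bigr do rewrite deg_sum_edges big_mkcond.
rewrite exchange_big big_mkcond /=; apply: eq_bigr => e _.
case: ifP => [/bigcupP [i _ eC]|eU].
  rewrite (bigD1 i) //= eC big1 ?addn0 // => j ji.
  by rewrite (disjointFl (disj _ _ ji) eC).
rewrite big1 // => i _; case: ifP => // eC.
by case/bigcupP: eU; exists i.
Qed.

Lemma card_le_sum_deg H : simple_graph H -> (#|H| <= \sum_v deg H v)%N.
Proof.
move=> sH; under eq_bigr do rewrite deg_sum_edges.
rewrite exchange_big /= -sum1_card leq_sum // => e eH.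
have [u [v _ ->]] := simple_edge_ends sH eH.
by rewrite (bigD1 u) //= !inE eqxx.
Qed.

Lemma MM_ge G M : matching G M -> (#|M| <= MM G)%N.
Proof. exact: (@leq_bigmax_cond _ (matching G) (fun M => #|M|)). Qed.

Lemma MM_witness G : exists2 M, matching G M & #|M| = MM G.
Proof.
have m0 : matching G set0.
  by rewrite /matching sub0set /=; apply/trivIsetP => A B; rewrite inE.
have [M mM ->] : {M | M \in matching G & MM G = #|M|}.
  by apply: eq_bigmax_cond; apply/card_gt0P; exists set0.
by exists M.
Qed.

Lemma MM_sub G H : H \subset G -> (MM H <= MM G)%N.
Proof.
move=> sHG; have [M /andP [sM tM] <-] := MM_witness H.
by apply: MM_ge; rewrite /matching tM (subset_trans sM).
Qed.

Section Edcs.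
Variable R : realType.
Implicit Types (b c : R).

Lemma edcsP b c G H :
  reflect [/\ H \subset G,
    forall u v, [set u; v] \in H -> (deg H u)%:R + (deg H v)%:R <= b
  & forall u v, [set u; v] \in G -> [set u; v] \notin H ->
      c <= (deg H u)%:R + (deg H v)%:R] (edcs b c G H).
Proof.
apply: (iffP and3P) => [[s /forallP h1 /forallP h2]|[s h1 h2]].
  split=> // u v.
    by move=> e; have /forallP/(_ v)/implyP/(_ e) := h1 u; rewrite natrD.
  move=> e e'; have /forallP/(_ v)/implyP := h2 u.
  by rewrite in_setD e e' natrD; apply.
split=> //; apply/forallP => u; apply/forallP => v; apply/implyP; rewrite natrD.
  exact: h1.
by rewrite in_setD => /andP [e' e]; apply: h2.
Qed.

Lemma edcs_weak b b' c c' G H :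
  b <= b' -> c' <= c -> edcs b c G H -> edcs b' c' G H.
Proof.
move=> bb cc /edcsP [s h1 h2]; apply/edcsP; split=> // u v e.
  exact: le_trans (h1 _ _ e) bb.
by move=> e'; apply: le_trans cc (h2 _ _ e e').
Qed.

Lemma edcs_deg_le b c G H v : simple_graph G -> 0 <= b -> edcs b c G H ->
  (deg H v)%:R <= b.
Proof.
move=> sG b0 /edcsP [s h1 _]; have sH := simple_graphS s sG.
have [->//|d0] := posnP (deg H v).
have [u /h1] := deg_gt0 sH d0; apply: le_trans.
by rewrite lerDl ler0n.
Qed.

(* A minimiser of [\sum_v (deg H v)^2 - 2 t #|H|] over the subgraphs of [G]:
   inserting or deleting one edge cannot decrease it. *)
Lemma edcs_exists (t : R) G : simple_graph G ->
  exists H, edcs (t + 1) (t - 1) G H.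
Proof.
move=> sG.
pose Phi H : R := (\sum_v (deg H v)%:R ^+ 2) - 2 * t * #|H|%:R.
have [H sHG minH] : exists2 H : {set {set V}}, H \subset G &
    forall H', H' \subset G -> Phi H <= Phi H'.
  case: (@Order.TotalTheory.arg_minP _ _ _ (set0 : {set {set V}})
    (fun H => H \subset G) Phi); first exact: sub0set.
  by move=> H sH h; exists H.
(* Two squares grow by [2 deg + 1] each, the penalty by [2 t]. Minimality is tested at [H] for
   insertion and at [H] minus the edge for deletion, where both end degrees are one lower; hence
   [t - 1] against [t + 1]. *)
have PhiU1 u v (F : {set {set V}}) : u != v -> [set u; v] \notin F ->
    Phi ([set u; v] |: F) = Phi F + 2 * ((deg F u)%:R + (deg F v)%:R + 1 - t).
  move=> uv eF; rewrite /Phi cardsU1 eF /= natrD.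
  have -> : \sum_w (deg ([set u; v] |: F) w)%:R ^+ 2 =
      (\sum_w (deg F w)%:R ^+ 2) +
      \sum_w (w \in [set u; v])%:R * (2 * (deg F w)%:R + 1) :> R.
    rewrite -big_split /=; apply: eq_bigr => w _.
    by rewrite deg_setU1 // natrD; case: (w \in _) => /=; ring.
  have -> : \sum_w (w \in [set u; v])%:R * (2 * (deg F w)%:R + 1) =
      (2 * (deg F u)%:R + 1) + (2 * (deg F v)%:R + 1) :> R.
    rewrite (bigD1 u) //= (bigD1 v) /=; last by rewrite eq_sym.
    rewrite !inE !eqxx orbT !mul1r big1 ?addr0 // => w /andP [wu wv].
    by rewrite !inE (negbTE wu) (negbTE wv) mul0r.
  ring.
exists H; apply/edcsP; split=> // u v.
  move=> eH; have uv := simple_edge_neq (simple_graphS sHG sG) eH.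
  have := minH _ (subset_trans (subsetDl H [set [set u; v]]) sHG).
  have {1}<- : [set u; v] |: (H :\ [set u; v]) = H by rewrite setD1K.
  rewrite PhiU1 ?setD11 //.
  rewrite (@deg_setD1 H _ u eH) (@deg_setD1 H _ v eH) !inE !eqxx orbT /= !natrD.
  lra.
move=> eG eH; have uv := simple_edge_neq sG eG.
have := minH ([set u; v] |: H); rewrite subUset sub1set eG sHG => /(_ isT).
rewrite PhiU1 //; lra.
Qed.

End Edcs.
End Graphs.

(** * Konig's theorem for bipartite graphs *)

Definition vcover (V : finType) (K : {set V}) (H : {set {set V}}) : bool :=
  [forall e in H, [exists v in K, v \in e]].

Section Konig.
Variable V : finType.
Implicit Types (F G H M : {set {set V}}) (K S : {set V}) (u v : V).

Lemma vcoverP K H :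
  reflect (forall e, e \in H -> exists2 v, v \in K & v \in e) (vcover K H).
Proof.
apply: (iffP forall_inP) => h e /h.
  by case/exists_inP => v vK ve; exists v.
by case=> v vK ve; apply/exists_inP; exists v.
Qed.

Lemma vcover_edge K H u v :
  vcover K H -> [set u; v] \in H -> (u \in K) || (v \in K).
Proof.
move=> /vcoverP c /c [w wK]; rewrite !inE => /orP [] /eqP <-.
  by rewrite wK.
by rewrite wK orbT.
Qed.

Lemma vcover_by_card F : simple_graph F ->
  exists2 K, vcover K F & (#|K| <= #|F|)%N.
Proof.
move=> sF; have [->|[e0 e0F]] := set_0Vmem F.
  by exists set0; rewrite ?cards0 //; apply/vcoverP => e; rewrite inE.
have [x0 _] := simple_edge_ends sF e0F.
pose f (e : {set V}) := odflt x0 [pick v in e].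
exists (f @: F); last exact: leq_imset_card.
apply/vcoverP => e eF; exists (f e); first exact: imset_f.
rewrite /f; case: pickP => //= h; have [u [v _ ee]] := simple_edge_ends sF eF.
by have := h u; rewrite ee !inE eqxx.
Qed.

(* In a bipartite subgraph that is minimal for its vertex cover number [t] no
   two edges [xy], [xz] meet: covers [S1], [S2] of size below [t] for the graph
   without [xy], resp. without [xz], would combine with the smaller side of
   [x |: (S1 symmetric difference S2)] into a cover of size below [t]. *)
Lemma konig (side : V -> bool) H : simple_graph H ->
  (forall u v, [set u; v] \in H -> side u != side v) ->
  exists2 K, vcover K H & (#|K| <= MM H)%N.
Proof.
move=> sH bip.
have cT : vcover setT H.
  apply/vcoverP => e eH; have [u [v _ ->]] := simple_edge_ends sH eH.
  by exists u; rewrite !inE ?eqxx.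
case: (@arg_minnP _ setT (fun K => vcover K H) (fun K : {set V} => #|K|) cT)
  => K0 cK0 minK0.
set t := #|K0|.
pose P (F : {set {set V}}) :=
  (F \subset H) && [forall K : {set V}, vcover K F ==> (t <= #|K|)%N].
have PH : P H.
  by rewrite /P subxx; apply/forallP => K; apply/implyP => /minK0.
case: (@arg_minnP _ H P (fun F : {set {set V}} => #|F|) PH)
  => F /andP [sFH minF] Fmin.
have sF := simple_graphS sFH sH.
have tF K : vcover K F -> (t <= #|K|)%N by move/forallP/(_ K)/implyP: minF.
(* The cover [S] of size below [t] cannot touch [e], or it would cover all of [F]. *)
have del e : e \in F -> exists2 S : {set V},
    vcover S (F :\ e) & (#|S| < t)%N /\ [disjoint e & S].
  move=> eF; have : ~~ P (F :\ e).
    apply/negP => /Fmin; rewrite (cardsD1 e F) eF; lia.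
  rewrite /P (subset_trans (subsetDl _ _) sFH) /= negb_forall.
  case/existsP => S; rewrite negb_imply -ltnNge => /andP [cS St].
  exists S => //; split=> //; apply/pred0P => v /=; apply/negP => /andP [ve vS].
  suff /tF : vcover S F by rewrite leqNgt St.
  apply/vcoverP => e' e'F; have [->|ne] := eqVneq e' e; first by exists v.
  by apply: (vcoverP _ _ cS); rewrite !inE ne.
exists K0 => //; rewrite -/t.
have mF : matching H F.
  rewrite /matching sFH; apply/trivIsetP => e f eF fF ef.
  apply/pred0P => x /=; apply/negP => /andP [xe xf].
  have [S1 cS1 [lS1 dS1]] := del _ eF.
  have [S2 cS2 [lS2 dS2]] := del _ fF.
  have xS1 : x \notin S1 by rewrite (disjointFr dS1 xe).
  have xS2 : x \notin S2 by rewrite (disjointFr dS2 xf).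
  pose D := x |: ((S1 :\: S2) :|: (S2 :\: S1)).
  pose T b := [set v in D | side v == b].
  (* An edge of [F] that misses [S1 :&: S2] has both ends in [D], hence one end in [D] on either
     side. *)
  have cT' b : vcover (T b :|: (S1 :&: S2)) F.
    have inD u v : [set u; v] \in F -> u \in D -> v \in D ->
        exists2 w, w \in T b :|: (S1 :&: S2) & w \in [set u; v].
      move=> uvF uD vD; have := bip _ _ (subsetP sFH _ uvF).
      have [su|su] := eqVneq (side u) b => sv.
        exists u; last exact: set21.
        by rewrite in_setU [u \in T b]in_set uD su eqxx.
      exists v; last by rewrite !inE eqxx orbT.
      rewrite in_setU [v \in T b]in_set vD /=.
      by move: su sv; case: (side u); case: (side v); case: b.
    apply/vcoverP => g gF.
    have xD : x \in D by rewrite !inE eqxx.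
    have [ge|ge] := eqVneq g e.
      have /(vcoverP _ _ cS2) [y yS2 yg] : g \in F :\ f by rewrite !inE ge ef.
      have yx : y != x by apply: contraNneq xS2 => <-.
      have eg : g = [set x; y].
        rewrite ge in yg *; have [z _ ez] := simple_edgeP sF eF xe.
        by move: yg; rewrite ez !inE (negbTE yx) /= => /eqP ->.
      have yS1 : y \notin S1 by rewrite (disjointFr dS1) // -ge.
      rewrite eg; apply: inD; rewrite -?eg //.
      by rewrite !inE yS2 yS1 !orbT.
    have [gf|gf] := eqVneq g f.
      have /(vcoverP _ _ cS1) [y yS1 yg] : g \in F :\ e.
        by rewrite !inE gf eq_sym ef.
      have yx : y != x by apply: contraNneq xS1 => <-.
      have eg : g = [set x; y].
        rewrite gf in yg *; have [z _ ez] := simple_edgeP sF fF xf.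
        by move: yg; rewrite ez !inE (negbTE yx) /= => /eqP ->.
      have yS2 : y \notin S2 by rewrite (disjointFr dS2) // -gf.
      rewrite eg; apply: inD; rewrite -?eg //.
      by rewrite !inE yS2 yS1 !orbT.
    have /(vcoverP _ _ cS1) [y yS1 yg] : g \in F :\ e by rewrite !inE ge.
    have /(vcoverP _ _ cS2) [z zS2 zg] : g \in F :\ f by rewrite !inE gf.
    have [yS2|yS2] := boolP (y \in S2).
      by exists y => //; rewrite !inE yS1 yS2 orbT.
    have [zS1|zS1] := boolP (z \in S1).
      by exists z => //; rewrite !inE zS1 zS2 orbT.
    have yz : z != y by apply: contraNneq yS2 => <-.
    have eg : g = [set y; z].
      have [w _ ew] := simple_edgeP sF gF yg.
      by move: zg; rewrite ew !inE (negbTE yz) /= => /eqP ->.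
    by rewrite eg; apply: inD; rewrite -?eg // !inE ?yS1 ?yS2 ?zS1 ?zS2 ?orbT.
  have cD : (#|T true| + #|T false| <= 1 + (#|S1 :\: S2| + #|S2 :\: S1|))%N.
    apply: (@leq_trans #|D|).
      rewrite -(cardsID [set v | side v] D) leq_add //;
        apply/subset_leq_card/subsetP => v; rewrite !inE.
        by case: (side v); rewrite ?andbT ?andbF.
      by case: (side v); rewrite ?andbT ?andbF.
    rewrite /D cardsU1; apply: leq_add; first by case: (_ \notin _).
    exact: leq_card_setU.
  (* Adding up the two covers gives [2 t <= 1 + #|S1| + #|S2| <= 2 t - 1], a contradiction. *)
  have h1 := leq_trans (tF _ (cT' true)) (leq_card_setU (T true) (S1 :&: S2)).1.
  have h2 := leq_trans (tF _ (cT' false)) (leq_card_setU (T false) (S1 :&: S2)).1.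
  have h3 := cardsID S2 S1; have h4 := cardsID S1 S2; rewrite setIC in h4.
  move: h1 h2 h3 h4 cD lS1 lS2; clear.
  move: #|T true| #|T false| #|S1 :&: S2| #|S1 :\: S2| #|S2 :\: S1| #|S1| #|S2|.
  lia.
have [K cK KF] := vcover_by_card sF.
exact: leq_trans (tF _ cK) (leq_trans KF (MM_ge mF)).
Qed.

End Konig.

(** * Matching size against cover size under degree constraints *)

Section Bipartite.
Variables (V : finType) (R : realType).
Implicit Types (H M : {set {set V}}) (K S : {set V}) (u v : V).

(** Cauchy-Schwarz, read off from the nonnegative variance of [f] on [A]. *)
Lemma sum_sqr_ge (A : {set V}) (f : V -> R) :
  (\sum_(i in A) f i) ^+ 2 <= #|A|%:R * \sum_(i in A) f i ^+ 2.
Proof.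
have [->|/set0Pn A0] := eqVneq A set0; first by rewrite !big_set0 mulr0 expr0n.
have a0 : 0 < #|A|%:R :> R by rewrite ltr0n; apply/card_gt0P.
set N := \sum_(i in A) f i; set a : R := #|A|%:R in a0 *.
have : 0 <= \sum_(i in A) (f i - N / a) ^+ 2.
  by apply: sumr_ge0 => i _; apply: sqr_ge0.
have -> : \sum_(i in A) (f i - N / a) ^+ 2 =
    \sum_(i in A) f i ^+ 2 - N ^+ 2 / a.
  transitivity (\sum_(i in A) (f i ^+ 2 + (- (2 * (N / a))) * f i + (N / a) ^+ 2)).
    by apply: eq_bigr => i _; ring.
  rewrite !big_split /= -mulr_sumr sumr_const -mulr_natl -/N -/a.
  by field; rewrite gt_eqF.
rewrite subr_ge0 ler_pdivrMr // mulrC; exact.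
Qed.

Lemma deg_matching H M v : matching H M -> (deg M v <= 1)%N.
Proof.
case/andP => _ /trivIsetP tM; apply/card_le1_eqP => e f; rewrite !inE.
case/andP => eM ve /andP [fM vf]; apply/eqP; apply: contraT => ef.
by have := disjointFr (tM _ _ fM eM ef) vf; rewrite ve.
Qed.

Lemma sum_deg_edges M (g : V -> R) :
  \sum_v (deg M v)%:R * g v = \sum_(e in M) \sum_(v in e) g v.
Proof.
under eq_bigr do rewrite deg_sum_edges natr_sum mulr_suml.
rewrite exchange_big /=; apply: eq_bigr => e _.
rewrite [RHS]big_mkcond /=; apply: eq_bigr => v _.
by case: (v \in e); rewrite ?mul1r ?mul0r.
Qed.

(** The [p] edges of [M] that avoid [K] have [2 p] ends, from which every [H]-edge goes into [K];
    there are [N >= b2 p] such edges. Summing the bound [b1] over them, Cauchy-Schwarz on both sides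
    yields [N^2 / (2 p) + N^2 / #|K| <= b1 N]. For [b1 = b2] the conclusion reads
    [2 #|M| <= 3 #|K|], the source of the ratio 3/2. *)
Lemma matching_le_cover G H M K (b1 b2 : R) :
  simple_graph H -> simple_graph M -> matching G M -> vcover K H ->
  0 < b2 -> b2 <= 2 * b1 ->
  (forall u v, [set u; v] \in H -> (deg H u)%:R + (deg H v)%:R <= b1) ->
  (forall u v, [set u; v] \in M -> [set u; v] \notin H ->
     b2 <= (deg H u)%:R + (deg H v)%:R) ->
  b2 * (2 * #|M|%:R - #|K|%:R) <= 2 * b1 * #|K|%:R.
Proof.
move=> sH sM mM cK b20 b21 hH hM.
pose M' := [set e in M | [disjoint e & K]].
have sM'M : M' \subset M by apply/subsetP => e; rewrite inE => /andP [].
have sM' := simple_graphS sM'M sM.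
(* An edge of [M] that meets [K] uses up a vertex of [K], and no vertex serves two edges of [M]. *)
have leM : (#|M| <= #|M'| + #|K|)%N.
  rewrite -(cardsID M' M) leq_add //.
    by apply: subset_leq_card; apply: subsetIr.
  apply: (@leq_trans (\sum_(v in K) deg M v)); last first.
    by rewrite -sum1_card; apply: leq_sum => v _; apply: deg_matching mM.
  under eq_bigr do rewrite deg_sum_edges.
  rewrite exchange_big /= -sum1_card [X in (_ <= X)%N](big_setID M') /=.
  apply: leq_trans (leq_addl _ _); apply: leq_sum => e.
  rewrite !inE => /andP [] + eM; rewrite eM /= => /pred0Pn [v /andP [ve vK]].
  by rewrite (bigD1 v) //= [v \in e]ve.
set p : R := #|M'|%:R; set c : R := #|K|%:R.
have c0 : 0 <= c by rewrite ler0n.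
have leM' : #|M|%:R <= p + c by rewrite -natrD ler_nat.
(* With [p = 0] there is nothing to divide by; then [#|M| <= #|K|], and [b2 <= 2 * b1] suffices. *)
have [M'0|M'0] := posnP #|M'|.
  have p0 : p = 0 by rewrite /p M'0.
  rewrite p0 add0r in leM'; nra.
have p0 : 0 < p by rewrite ltr0n.
pose X := [set v | (0 < deg M' v)%N].
have inX v : (v \in X)%:R = (deg M' v)%:R :> R.
  rewrite inE; have := leq_trans (degS v sM'M) (deg_matching v mM).
  by case: (deg M' v) => [|[|]].
have sumX (g : V -> R) : \sum_(v in X) g v = \sum_(e in M') \sum_(v in e) g v.
  rewrite -sum_deg_edges // big_mkcond /=; apply: eq_bigr => v _.
  by rewrite -inX; case: (v \in X); rewrite ?mul1r ?mul0r.
have cardX : #|X|%:R = 2 * p.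
  rewrite -sum1_card natr_sum sumX.
  transitivity (\sum_(e in M') 2 : R).
    apply: eq_bigr => e eM; rewrite sumr_const.
    by have /forall_inP/(_ _ eM)/eqP -> := sM'.
  by rewrite sumr_const -(mulr_natr 2).
have XK v : v \in X -> v \notin K.
  rewrite inE => /card_gt0P [e]; rewrite !inE -andbA => /and3P [_ dK ve].
  by rewrite (disjointFr dK ve).
pose a u v : R := ([set u; v] \in H)%:R.
have aC u v : a u v = a v u by rewrite /a setUC.
have a0 u v : 0 <= a u v by rewrite ler0n.
have degE u : (deg H u)%:R = \sum_v a u v by rewrite deg_sum_nbr // natr_sum.
have degX u : u \in X -> (deg H u)%:R = \sum_(w in K) a u w.
  move=> uX; rewrite degE [RHS]big_mkcond /=; apply: eq_bigr => w _.
  case: ifP => // wK; rewrite /a; case: (boolP (_ \in H)) => // uw.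
  by have := vcover_edge cK uw; rewrite wK (negbTE (XK _ uX)).
pose N : R := \sum_(u in X) (deg H u)%:R.
pose cd w : R := \sum_(u in X) a u w.
have N_K : N = \sum_(w in K) cd w.
  by rewrite /N (eq_bigr _ degX) exchange_big.
have N_ge : b2 * p <= N.
  rewrite /N sumX mulrC /p -sum1_card natr_sum mulr_suml ler_sum // => e eM'.
  have [u [v uv ee]] := simple_edge_ends sM' eM'.
  rewrite mul1r ee big_setU1 ?inE //= big_set1 hM -?ee ?(subsetP sM'M) //.
  apply/negP => /(vcoverP _ _ cK) [w wK we].
  by move: eM'; rewrite inE => /andP [_ /disjointFr /(_ we)]; rewrite wK.
have N0 : 0 < N by apply: lt_le_trans N_ge; apply: mulr_gt0.
have bN : \sum_(u in X) (deg H u)%:R ^+ 2 + \sum_(w in K) cd w ^+ 2 <= b1 * N.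
  have -> : \sum_(u in X) (deg H u)%:R ^+ 2 =
      \sum_(u in X) \sum_(w in K) a u w * (deg H u)%:R :> R.
    apply: eq_bigr => u uX; rewrite -mulr_suml -degX // expr2 //.
  have -> : b1 * N = \sum_(u in X) \sum_(w in K) a u w * b1.
    rewrite /N mulr_sumr; apply: eq_bigr => u uX.
    by rewrite -mulr_suml -degX // mulrC.
  have -> : \sum_(w in K) cd w ^+ 2 = \sum_(u in X) \sum_(w in K) a u w * cd w.
    by rewrite exchange_big /=; apply: eq_bigr => w _; rewrite -mulr_suml expr2.
  rewrite -big_split /= ler_sum // => u uX; rewrite -big_split /= ler_sum // => w _.
  rewrite -mulrDr /a; case: (boolP (_ \in H)) => uw; rewrite ?mul0r // !mul1r.
  apply: le_trans (hH _ _ uw); rewrite lerD2l degE /cd.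
  rewrite [X in _ <= X](bigID (mem X)) /=.
  under eq_bigr do rewrite aC.
  by rewrite lerDl sumr_ge0.
have := sum_sqr_ge X (fun u => (deg H u)%:R); rewrite -/N cardX => sX.
have := sum_sqr_ge K cd; rewrite -N_K -/c => sK.
set SX := \sum_(u in X) _ in bN sX; set SK := \sum_(w in K) _ in bN sK.
have cp : N * (c + 2 * p) <= 2 * p * c * b1.
  rewrite -(ler_pM2l N0).
  have : c * (2 * p * SX) + 2 * p * (c * SK) <= 2 * p * c * (b1 * N).
    have -> : c * (2 * p * SX) + 2 * p * (c * SK) = 2 * p * c * (SX + SK) by ring.
    by apply: ler_wpM2l => //; rewrite !mulr_ge0 // ltW.
  have : c * N ^+ 2 <= c * (2 * p * SX) by apply: ler_wpM2l.
  have : 2 * p * N ^+ 2 <= 2 * p * (c * SK).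
    by apply: ler_wpM2l => //; rewrite mulr_ge0 // ltW.
  lra.
have cp' : b2 * (c + 2 * p) <= 2 * b1 * c.
  rewrite -(ler_pM2l p0).
  have : b2 * p * (c + 2 * p) <= N * (c + 2 * p).
    by apply: ler_wpM2r => //; rewrite addr_ge0 // mulr_ge0 // ltW.
  lra.
apply: le_trans cp'; rewrite ler_pM2l //; lra.
Qed.

End Bipartite.

(** * Two EDCSs of one graph have close degrees *)

Section DegreeGap.
Variables (V : finType) (R : realType).
Implicit Types (A B G P Q : {set {set V}}) (x : V -> R).

(** Double counting: an edge at a vertex with [a <= x v] has its other end at value at most
    [s - a]. *)
Lemma sum_deg_across P x (a s : R) : simple_graph P ->
  (forall u v, [set u; v] \in P -> x u + x v <= s) ->
  \sum_(v | a <= x v) (deg P v)%:R <=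
  \sum_(v | x v <= s - a) (deg P v)%:R :> R.
Proof.
move=> sP hP.
under eq_bigr do rewrite deg_sum_nbr // natr_sum.
under [X in _ <= X]eq_bigr do rewrite deg_sum_nbr // natr_sum.
rewrite [X in X <= _]big_mkcond [X in _ <= X]big_mkcond /=.
have -> : \sum_v (if x v <= s - a then \sum_u ([set v; u] \in P)%:R else 0) =
    \sum_v \sum_u (if x u <= s - a then ([set u; v] \in P)%:R else 0) :> R.
  rewrite [RHS]exchange_big /=; apply: eq_bigr => v _.
  by case: ifP => // _; rewrite big1.
apply: ler_sum => v _; case: ifP => av; last first.
  by apply: sumr_ge0 => u _; case: ifP.
apply: ler_sum => u _; rewrite setUC.
case: (boolP (_ \in P)) => [/hP h|_]; last by case: ifP.
by rewrite ifT //; lra.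
Qed.

(** In the application [P] and [Q] are the two one-sided differences of a pair of EDCSs and [x] is
    their degree difference; each tail counts the edges of the side in excess there. *)
Definition tail_mass P Q x (a : R) : R :=
  \sum_(v | a <= x v) (deg P v)%:R + \sum_(v | x v <= - a) (deg Q v)%:R.

(** A [P]-edge at a vertex with [x >= a + s] leads to one with [x <= - a], where the [P]-degree is
    at least [h] below the [Q]-degree. As the latter is at most [D], this gains a factor
    [1 - h / D <= expR (- (h / D))]. The case of [Q] is symmetric. *)
Lemma tail_mass_step P Q x (a s h D : R) : simple_graph P -> simple_graph Q ->
  (forall v, x v = (deg P v)%:R - (deg Q v)%:R) ->
  (forall u v, [set u; v] \in P -> x u + x v <= s) ->
  (forall u v, [set u; v] \in Q -> - s <= x u + x v) ->
  (forall v, (deg P v)%:R <= D) -> (forall v, (deg Q v)%:R <= D) ->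
  0 < D -> 0 < h -> h <= a ->
  tail_mass P Q x (a + s) <= tail_mass P Q x a * expR (- (h / D)).
Proof.
move=> sP sQ xE hP hQ dP dQ D0 h0 ha.
have hQ' u v : [set u; v] \in Q -> - x u + - x v <= s by move/hQ; lra.
have shrink (d e : R) : 0 <= d -> d <= D -> e <= d - h -> e <= d * expR (- (h / D)).
  move=> d0 dD /le_trans; apply.
  apply: le_trans (ler_wpM2l d0 (expR_ge1Dx _)).
  rewrite mulrDr mulr1 mulrN lerD2l lerN2 mulrC.
  rewrite -[X in _ <= X]mulr1 -mulrA ler_pM2l //.
  by rewrite mulrC ler_pdivrMr // mul1r.
rewrite /tail_mass mulrDl addrC; apply: lerD.
  have := @sum_deg_across Q (fun v => - x v) (a + s) s sQ hQ'.
  rewrite (eq_bigl (fun v => x v <= - (a + s))); last by move=> v; rewrite lerNr.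
  move/le_trans; apply; rewrite mulr_suml.
  rewrite (eq_bigl (fun v => a <= x v)); last by move=> v; apply/idP/idP; lra.
  apply: ler_sum => v av; apply: shrink => //.
  by have := xE v; lra.
have := @sum_deg_across P x (a + s) s sP hP.
move/le_trans; apply; rewrite mulr_suml.
rewrite (eq_bigl (fun v => x v <= - a)); last by move=> v; apply/idP/idP; lra.
apply: ler_sum => v av; apply: shrink => //.
by have := xE v; lra.
Qed.

(** The tail mass is at most [2 #|V|^2] at threshold [h] and decays over [J] steps of width
    [2 * eta] to below 1. A vertex beyond the last threshold would alone contribute at least 1,
    degrees being integers. *)
Lemma edcs_degree_gap_le G A B (b eta h : R) (J : nat) v : simple_graph G ->
  edcs (b + eta) (b - eta) G A -> edcs (b + eta) (b - eta) G B ->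
  0 < b -> 0 <= eta -> 0 < h ->
  2 * #|V|%:R ^+ 2 * expR (- (J%:R * (h / (b + eta)))) < 1 ->
  (deg A v)%:R - (deg B v)%:R <= h + J%:R * (2 * eta).
Proof.
move=> sG eA eB b0 eta0 h0 small.
have D0 : 0 < b + eta by lra.
have dA u := edcs_deg_le u sG (ltW D0) eA.
have dB u := edcs_deg_le u sG (ltW D0) eB.
have /edcsP [sAG A1 A2] := eA; have /edcsP [sBG B1 B2] := eB.
pose P := A :\: B; pose Q := B :\: A.
pose x u : R := (deg A u)%:R - (deg B u)%:R.
have sP : simple_graph P := simple_graphS (subset_trans (subsetDl _ _) sAG) sG.
have sQ : simple_graph Q := simple_graphS (subset_trans (subsetDl _ _) sBG) sG.
have xE u : x u = (deg P u)%:R - (deg Q u)%:R.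
  rewrite /x -(deg_setD A B) -(deg_setD B A) (setIC B A) !natrD /P /Q; ring.
have hP u w : [set u; w] \in P -> x u + x w <= 2 * eta.
  rewrite inE => /andP [eB' eA']; have := A1 _ _ eA'.
  have := B2 _ _ (subsetP sAG _ eA') eB'; rewrite /x; lra.
have hQ u w : [set u; w] \in Q -> - (2 * eta) <= x u + x w.
  rewrite inE => /andP [eA' eB']; have := B1 _ _ eB'.
  have := A2 _ _ (subsetP sBG _ eB') eA'; rewrite /x; lra.
have dP u : (deg P u)%:R <= b + eta.
  by apply: le_trans (dA u); rewrite ler_nat degS // subsetDl.
have dQ u : (deg Q u)%:R <= b + eta.
  by apply: le_trans (dB u); rewrite ler_nat degS // subsetDl.
have mass0 : tail_mass P Q x h <= 2 * #|V|%:R ^+ 2.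
  have bnd (pr : pred V) (F : {set {set V}}) : simple_graph F ->
      \sum_(u | pr u) (deg F u)%:R <= #|V|%:R ^+ 2 :> R.
    move=> sF; apply: (@le_trans _ _ (\sum_(u : V) #|V|%:R)).
      rewrite big_mkcond; apply: ler_sum => u _; case: ifP => // _.
      by rewrite ler_nat deg_le_card.
    by rewrite sumr_const -[_ *+ _]mulr_natr expr2.
  have := bnd (fun u => h <= x u) _ sP.
  have := bnd (fun u => x u <= - h) _ sQ.
  rewrite /tail_mass; lra.
have iter j : tail_mass P Q x (h + j%:R * (2 * eta)) <=
    2 * #|V|%:R ^+ 2 * expR (- (j%:R * (h / (b + eta)))).
  elim: j => [|j IH]; first by rewrite !mul0r oppr0 expR0 addr0 mulr1.
  have -> : h + j.+1%:R * (2 * eta) = h + j%:R * (2 * eta) + 2 * eta.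
    by rewrite -[j.+1]addn1 natrD; ring.
  have hle : h <= h + j%:R * (2 * eta) by rewrite lerDl !mulr_ge0.
  apply: le_trans (tail_mass_step sP sQ xE hP hQ dP dQ D0 h0 hle) _.
  have -> : - (j.+1%:R * (h / (b + eta))) =
      - (j%:R * (h / (b + eta))) + - (h / (b + eta)).
    by rewrite -[j.+1]addn1 natrD; ring.
  by rewrite expRD [_ * (expR _ * _)]mulrA ler_wpM2r // expR_ge0.
rewrite leNgt; apply/negP => big.
have : tail_mass P Q x (h + J%:R * (2 * eta)) < 1 := le_lt_trans (iter J) small.
apply/negP; rewrite -leNgt /tail_mass.
have x0 : 0 < x v by apply: lt_trans big; rewrite ltr_wpDr // !mulr_ge0.
rewrite (bigD1 v) /=; last exact: ltW.
have : (1 : R) <= (deg P v)%:R.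
  rewrite ler1n -(ltr_nat R); apply: lt_le_trans x0 _; rewrite xE.
  by rewrite gerBl.
have s1 : 0 <= \sum_(u | (h + J%:R * (2 * eta) <= x u) && (u != v)) (deg P u)%:R :> R.
  by apply: sumr_ge0.
have s2 : 0 <= \sum_(u | x u <= - (h + J%:R * (2 * eta))) (deg Q u)%:R :> R.
  by apply: sumr_ge0.
lra.
Qed.

End DegreeGap.

(** * Exponential bounds and finite product probability *)

(** Combine [expR x <= 1 / (1 - x)] with [(1 + x + 2 x^2) (1 - x) = 1 + x^2 (1 - 2 x)]. Negative [x]
    is allowed, so both tails are served. *)
Lemma expR_le_quad (R : realType) (x : R) : x <= 1 / 2 ->
  expR x <= 1 + x + 2 * x ^+ 2.
Proof.
move=> x2; have h := expR_ge1Dx (- x); rewrite expRN in h.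
have x1 : 0 < 1 - x by lra.
have e0 := expR_gt0 x.
have : expR x * (1 - x) <= 1.
  by rewrite -ler_pdivlMl // mulr1.
move=> h1; rewrite -(ler_pM2r x1); apply: le_trans h1 _.
have : 0 <= x ^+ 2 * (1 - 2 * x) by rewrite mulr_ge0 ?sqr_ge0 //; lra.
lra.
Qed.

Section Product.
Variables (R : realType) (I T : finType).
Implicit Types (A B : pred {ffun I -> T}).

(** Expectation over independent uniform choices. The weight stays a product over [I], as in
    [Pr_kpartition], so that expectations of products factorise. *)
Definition Ex (g : {ffun I -> T} -> R) : R :=
  \sum_f g f * \prod_(i : I) #|T|%:R^-1.

Definition Pr (A : pred {ffun I -> T}) : R :=
  \sum_(f | A f) \prod_(i : I) #|T|%:R^-1.

Lemma weight_ge0 : 0 <= \prod_(i : I) #|T|%:R^-1 :> R.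
Proof. by apply: prodr_ge0 => i _; rewrite invr_ge0. Qed.

Lemma PrE A : Pr A = Ex (fun f => (A f)%:R).
Proof.
rewrite /Pr big_mkcond; apply: eq_bigr => f _.
by case: (A f); rewrite ?mul1r ?mul0r.
Qed.

Lemma Ex_le g h : (forall f, g f <= h f) -> Ex g <= Ex h.
Proof. by move=> gh; apply: ler_sum => f _; rewrite ler_wpM2r ?weight_ge0. Qed.

Lemma Pr_sub A B : (forall f, A f -> B f) -> Pr A <= Pr B.
Proof.
move=> AB; rewrite !PrE; apply: Ex_le => f; rewrite ler_nat.
by case: (boolP (A f)) => // /AB ->.
Qed.

Lemma Pr_union (J : finType) (B : J -> pred {ffun I -> T}) :
  Pr (fun f => [exists j, B j f]) <= \sum_j Pr (B j).
Proof.
under eq_bigr do rewrite PrE.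
rewrite PrE /Ex exchange_big /=; apply: ler_sum => f _.
rewrite -mulr_suml ler_wpM2r ?weight_ge0 //.
case: (boolP [exists j, B j f]) => [/existsP [j Bj]|_]; last exact: sumr_ge0.
by rewrite (bigD1 j) //= Bj lerDl sumr_ge0.
Qed.

Lemma Ex_prod (F : I -> T -> R) :
  Ex (fun f => \prod_i F i (f i)) = \prod_i \sum_t (F i t / #|T|%:R).
Proof.
by rewrite bigA_distr_bigA; apply: eq_bigr => f _; rewrite big_split.
Qed.

Lemma markov (g : {ffun I -> T} -> R) (c : R) : 0 < c ->
  (forall f, 0 <= g f) -> Pr (fun f => c <= g f) <= Ex g / c.
Proof.
move=> c0 g0; rewrite ler_pdivlMr // PrE /Ex mulr_suml; apply: ler_sum => f _.
rewrite mulrAC ler_wpM2r ?weight_ge0 //.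
by case: (boolP (c <= g f)); rewrite ?mul1r ?mul0r.
Qed.

Lemma Ex_expR_le (X : I -> T -> R) (m : I -> R) :
  (forall i, \sum_t (expR (X i t) / #|T|%:R) <= expR (m i)) ->
  Ex (fun f => expR (\sum_i X i (f i))) <= expR (\sum_i m i).
Proof.
move=> h; rewrite expR_sum.
rewrite [leLHS](_ : _ = Ex (fun f => \prod_i expR (X i (f i)))); last first.
  by apply: eq_bigr => f _; rewrite expR_sum.
rewrite (Ex_prod (fun i t => expR (X i t))); apply: ler_prod => i _; rewrite h andbT.
by apply: sumr_ge0 => t _; rewrite divr_ge0 ?expR_ge0.
Qed.

(** Markov's inequality for the exponential; the Chernoff parameter is absorbed into [X] and [s]. *)
Lemma chernoff (X : I -> T -> R) (m : I -> R) (s : R) :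
  (forall i, \sum_t (expR (X i t) / #|T|%:R) <= expR (m i)) ->
  Pr (fun f => s <= \sum_i X i (f i)) <= expR (\sum_i m i - s).
Proof.
move=> h; rewrite expRB.
pose g (f : {ffun I -> T}) := expR (\sum_i X i (f i)).
apply: (@le_trans _ _ (Pr (fun f => expR s <= g f))).
  by apply: Pr_sub => f; rewrite ler_expR.
apply: (@le_trans _ _ (Ex g / expR s)).
  by apply: markov; rewrite ?expR_gt0 // => f; exact: expR_ge0.
by rewrite ler_wpM2r ?invr_ge0 ?expR_ge0 // Ex_expR_le.
Qed.

Hypothesis T0 : (0 < #|T|)%N.

Lemma Pr_total : Pr predT = 1.
Proof.
have -> : Pr predT = Ex (fun f => \prod_(i : I) 1).
  by apply: eq_bigr => f _; rewrite [X in _ = X * _]big1 ?mul1r.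
rewrite (Ex_prod (fun _ _ => 1)) big1 // => i _.
rewrite sumr_const mul1r -[_ *+ _]mulr_natr mulVf //.
by rewrite pnatr_eq0 -lt0n.
Qed.

Lemma PrC A : Pr A = 1 - Pr (predC A).
Proof. by rewrite -Pr_total /Pr (bigID A predT) /= addrK. Qed.

Lemma Pr_lt1_exists A : Pr A < 1 -> exists f, ~~ A f.
Proof.
move=> h; apply/existsP; apply: contraTT h => /existsPn h.
rewrite -leNgt -Pr_total; apply: Pr_sub => f _; exact: negbNE (h f).
Qed.

End Product.

Arguments Pr R {I T} A.

(** * Random bipartitions and the ratio 3/2 *)

Section Bipartition.
Variables (V : finType) (R : realType).
Implicit Types (G H M : {set {set V}}).

Definition cross (side : V -> bool) H : {set {set V}} :=
  [set e in H | [exists u in e, exists v in e, side u != side v]].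

Lemma cross_sub side H : cross side H \subset H.
Proof. by apply/subsetP => e; rewrite inE => /andP []. Qed.

Lemma in_cross side H u v :
  ([set u; v] \in cross side H) = ([set u; v] \in H) && (side u != side v).
Proof.
rewrite inE; congr (_ && _); apply/exists_inP/idP => [[a]|uv].
  rewrite !inE => ha /exists_inP [b]; rewrite !inE => hb.
  by case/orP: ha hb => /eqP -> /orP [] /eqP ->; rewrite ?eqxx // eq_sym.
exists u; first exact: set21.
by apply/exists_inP; exists v => //; apply: set22.
Qed.

(** Crossing edges count +1 and the others -1, which makes the imbalance at [v] a linear form in the
    signs of the sides. *)
Lemma deg_cross side H v : simple_graph H ->
  (2 * (deg (cross side H) v)%:R - (deg H v)%:R : R) =
  - (-1) ^+ side v * \sum_u ([set v; u] \in H)%:R * (-1) ^+ side u.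
Proof.
move=> sH; have sC := simple_graphS (cross_sub side H) sH.
rewrite !deg_sum_nbr // !natr_sum !mulr_sumr -sumrB; apply: eq_bigr => u _.
rewrite in_cross; case: (_ \in H); case: (side u); case: (side v) => /=;
  rewrite ?expr0 ?expr1; ring.
Qed.

(** One representative per edge of [M]; a vertex missed by [M] has an empty block and, by the
    default, represents itself. *)
Definition block_rep M u : V := odflt u [pick x in pblock M u].

Lemma block_rep_edge M u : simple_graph M ->
  block_rep M u != u -> [set block_rep M u; u] \in M.
Proof.
move=> sM; rewrite /block_rep; case: pickP => [x xu|_] /=; last by rewrite eqxx.
move: xu; rewrite /pblock; case: pickP => [B /andP [BM uB] /= xB|_ /=]; last first.
  by rewrite inE.
have [y _ eB] := simple_edgeP sM BM uB.
move: xB; rewrite eB !inE => /orP [/eqP ->|/eqP ->]; first by rewrite eqxx.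
by rewrite setUC -eB.
Qed.

Lemma block_rep_pair G M u v : matching G M -> [set u; v] \in M ->
  block_rep M u = block_rep M v /\ block_rep M u \in [set u; v].
Proof.
case/andP => _ tM eM; rewrite /block_rep.
rewrite (def_pblock tM eM (set21 _ _)) (def_pblock tM eM (set22 _ _)).
by case: pickP => [x|/(_ u)] //=; rewrite set21.
Qed.

(** A fibre holds at most [w] and its partner in [M], with opposite signs, so [c] is a difference of
    two 0/1 values. The quadratic bound lets the variances of all fibres add up to at most a
    degree. *)
Lemma fibre_sign_sum G M (a : V -> bool) w : simple_graph M -> matching G M ->
  let c : R := \sum_(u | block_rep M u == w)
    (a u)%:R * (-1) ^+ (block_rep M u != u) in
  `|c| <= 1 /\ c ^+ 2 <= \sum_(u | block_rep M u == w) (a u)%:R.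
Proof.
move=> sM mM c.
pose y := (\sum_(u | (block_rep M u == w) && (u != w)) a u)%N.
have y1 : (y <= 1)%N.
  apply: leq_trans (deg_matching w mM); rewrite deg_sum_nbr // /y big_mkcond /=.
  apply: leq_sum => u _; case: ifP => // /andP [/eqP rw uw].
  have := @block_rep_edge M u sM; rewrite rw eq_sym => /(_ uw) ->.
  by case: (a u).
pose x : bool := (block_rep M w == w) && a w.
have -> : \sum_(u | block_rep M u == w) (a u)%:R = x%:R + y%:R :> R.
  rewrite (bigID (pred1 w)) /=; congr (_ + _); last by rewrite natr_sum.
  rewrite big_andbC big_mkcondr big_pred1_eq /x.
  by case: eqP.
have -> : c = x%:R - y%:R.
  rewrite /c (bigID (pred1 w)) /=; congr (_ + _).
    rewrite big_andbC big_mkcondr big_pred1_eq /x.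
    by case: eqP => //= _; rewrite expr0 mulr1.
  rewrite natr_sum -sumrN; apply: eq_bigr => u /andP [/eqP -> uw].
  by rewrite eq_sym uw expr1 mulrN1.
case: (x); case: (y) y1 => [|[|]] // _; rewrite ?subr0 ?subrr ?sub0r ?normrN
  ?normr0 ?normr1 ?expr0n ?expr1n ?sqrrN ?expr1n ?addr0 ?add0r //=; lra.
Qed.

Lemma rademacher_mgf (x : R) : `|x| <= 1 / 2 ->
  \sum_(t : bool) (expR (x * (-1) ^+ t) / #|{: bool}|%:R) <= expR (2 * x ^+ 2).
Proof.
rewrite ler_norml => /andP [x1 x2].
rewrite card_bool big_bool /= expr0 expr1 mulr1 mulrN1.
have h1 := @expR_le_quad R x x2.
have h2 : expR (- x) <= 1 + - x + 2 * (- x) ^+ 2 by apply: expR_le_quad; lra.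
have h3 := expR_ge1Dx (2 * x ^+ 2); lra.
Qed.

(** One fair bit per representative, flipped at the other end, makes every edge of [M] cross. The
    imbalance at [v] is then a sum of independent signs with coefficients [c v w], and [2 #|V|]
    Chernoff tails enter a union bound. *)
Lemma balanced_bipartition G H M (D s th : R) :
  simple_graph H -> simple_graph M -> matching G M ->
  (forall v, (deg H v)%:R <= D) -> 0 < th -> th <= 1 / 2 ->
  2 * #|V|%:R * expR (2 * th ^+ 2 * D - th * s) < 1 ->
  exists2 side : V -> bool,
    (forall u v, [set u; v] \in M -> side u != side v)
  & forall v, `|2 * (deg (cross side H) v)%:R - (deg H v)%:R| <= s.
Proof.
move=> sH sM mM dH th0 th2 small.
pose r := block_rep M.
pose side (b : {ffun V -> bool}) u := b (r u) (+) (r u != u).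
pose c v w : R := \sum_(u | r u == w) ([set v; u] \in H)%:R * (-1) ^+ (r u != u).
pose S v (b : {ffun V -> bool}) := \sum_w th * c v w * (-1) ^+ (b w).
have SE v b : \sum_u ([set v; u] \in H)%:R * (-1) ^+ side b u = S v b / th.
  rewrite /S mulr_suml (partition_big r predT) //=; apply: eq_bigr => w _.
  transitivity (c v w * (-1) ^+ b w); last by field; rewrite gt_eqF.
  rewrite /c mulr_suml.
  apply: eq_bigr => u /eqP rw.
  by rewrite /side signr_addb rw mulrA mulrAC.
have tail (sg : R) v : `|sg| = 1 ->
    Pr R (fun b : {ffun V -> bool} => th * s <= sg * S v b) <=
    expR (2 * th ^+ 2 * D - th * s).
  move=> sg1.
  pose m w : R := 2 * th ^+ 2 * \sum_(u | r u == w) ([set v; u] \in H)%:R.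
  have mle : \sum_w m w <= 2 * th ^+ 2 * D.
    rewrite -mulr_sumr ler_wpM2l ?mulr_ge0 ?(ltW th0) //.
    apply: le_trans (dH v); rewrite deg_sum_nbr // natr_sum.
    by rewrite [leRHS](partition_big r predT).
  apply: (@le_trans _ _ (expR (\sum_w m w - th * s))); last first.
    by rewrite ler_expR lerD2r.
  pose X w (t : bool) := sg * th * c v w * (-1) ^+ t.
  apply: (@le_trans _ _ (Pr R (fun b => th * s <= \sum_w X w (b w)))).
    apply: Pr_sub => b; rewrite /S mulr_sumr.
    by under eq_bigr do rewrite !mulrA.
  apply: chernoff.
  move=> w; have [c1 c2] :=
    @fibre_sign_sum G M (fun u => [set v; u] \in H) w sM mM.
  rewrite -/r -/(c v w) in c1 c2.
  apply: le_trans (rademacher_mgf _) _.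
    rewrite !normrM sg1 (gtr0_norm th0) [1 * th]mul1r.
    by apply: le_trans th2; rewrite -[leRHS]mulr1 ler_pM2l.
  rewrite ler_expR (_ : 2 * _ ^+ 2 = 2 * th ^+ 2 * c v w ^+ 2).
    by apply: ler_wpM2l => //; rewrite mulr_ge0 // sqr_ge0.
  by rewrite !exprMn -[sg ^+ 2]real_normK ?num_real // sg1 expr1n mul1r mulrA.
pose B (j : V * bool) (b : {ffun V -> bool}) := th * s <= (-1) ^+ j.2 * S j.1 b.
have [b /existsPn good] : exists b, ~~ [exists j, B j b].
  apply: (@Pr_lt1_exists R V bool); first by rewrite card_bool.
  apply: (le_lt_trans (@Pr_union R V bool _ B)); apply: le_lt_trans small.
  apply: (@le_trans _ _ (\sum_(j : V * bool) expR (2 * th ^+ 2 * D - th * s))).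
    by apply: ler_sum => j _; apply: tail; rewrite normr_sign.
  rewrite sumr_const card_prod card_bool -[_ *+ _]mulr_natl natrM.
  by rewrite [_ * 2]mulrC.
exists (side b).
  move=> u v uvM; have [ruv] := block_rep_pair mM uvM.
  have uv := simple_edge_neq sM uvM.
  rewrite /side -/r in ruv *; rewrite -/(r u) -ruv !inE.
  case/orP => /eqP ->; rewrite eqxx ?uv ?[v == u]eq_sym ?uv; by case: (b _).
move=> v; rewrite deg_cross // normrM normrN normr_sign mul1r SE.
rewrite normrM normfV (gtr0_norm th0) ler_pdivrMr // mulrC ler_norml.
have := good (v, false); have := good (v, true).
rewrite /B /= expr0 expr1 mul1r mulN1r -!ltNge => h1 h2.
by rewrite (ltW h2) andbT lerNl ltW.
Qed.

(** The crossing part [C] has half the degrees of [H] up to [r b / 4]. So edge degrees in [C] are at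
    most [(1 + 2 r) b / 2] on [C] and at least [(1 - 2 r) b / 2] on the edges of [M] outside [C]; a
    Konig cover of [C] has size at most [MM C <= MM H]. *)
Lemma edcs_MM_le G H (b r : R) : simple_graph G -> 0 < b -> 0 < r -> r < 1 / 4 ->
  2 * #|V|%:R * expR (- (r ^+ 2 * b / 64)) < 1 ->
  edcs ((1 + r) * b) ((1 - r) * b) G H ->
  2 * (1 - 2 * r) * (MM G)%:R <= (3 + 2 * r) * (MM H)%:R.
Proof.
move=> sG b0 r0 r4 small eH; have /edcsP [sHG H1 H2] := eH.
have sH := simple_graphS sHG sG.
have [M mM <-] := MM_witness G.
have sM : simple_graph M by apply: simple_graphS sG; case/andP: mM.
have dH v : (deg H v)%:R <= 2 * b.
  have rb : r * b <= 1 / 4 * b by rewrite ler_pM2r // ltW.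
  by apply: le_trans (edcs_deg_le v sG _ eH) _; [apply: mulr_ge0; lra | lra].
(* The choice [r / 16] minimises [2 th^2 (2 b) - th r b / 2], with value [- (r^2 b / 64)]. *)
have [|||side cM dC] := @balanced_bipartition G H M (2 * b) (r * b / 2) (r / 16)
  sH sM mM dH.
- by lra.
- by lra.
- rewrite (_ : _ - _ = - (r ^+ 2 * b / 64)) //; by field.
set C := cross side H in dC.
have sC : simple_graph C := simple_graphS (cross_sub side H) sH.
have [|K cK leK] := @konig V side C sC.
  by move=> u v; rewrite in_cross => /andP [].
have rb0 : 0 < r * b by apply: mulr_gt0.
have rb4 : r * b < 1 / 4 * b by rewrite ltr_pM2r.
have near v : (deg H v)%:R / 2 - r * b / 4 <= (deg C v)%:R :> R /\
    (deg C v)%:R <= (deg H v)%:R / 2 + r * b / 4 :> R.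
  by have := dC v; rewrite ler_norml => /andP [h1 h2]; lra.
have := @matching_le_cover V R G C M K ((1 + 2 * r) * b / 2) ((1 - 2 * r) * b / 2)
  sC sM mM cK.
have -> : (1 + 2 * r) * b / 2 = b / 2 + r * b by field.
have -> : (1 - 2 * r) * b / 2 = b / 2 - r * b by field.
move=> main.
have {main} : (b / 2 - r * b) * (2 * #|M|%:R - #|K|%:R) <= 2 * (b / 2 + r * b) * #|K|%:R.
  apply: main; [lra|lra| |].
    move=> u v; rewrite in_cross => /andP [/H1 h _].
    have [_] := near u; have [_] := near v; lra.
  (* All of [M] crosses, so an edge of [M] outside [C] is outside [H], and (P2) applies. *)
  move=> u v uvM; rewrite in_cross (cM _ _ uvM) andbT => uvH.
  have := H2 _ _ (subsetP (proj1 (andP mM)) _ uvM) uvH.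
  have [+ _] := near u; have [+ _] := near v; lra.
have -> : (b / 2 - r * b) * (2 * #|M|%:R - #|K|%:R) =
  b * (2 * (1 - 2 * r) * #|M|%:R - (1 - 2 * r) * #|K|%:R) / 2 by field.
have -> : 2 * (b / 2 + r * b) * #|K|%:R = b * (2 * (1 + 2 * r) * #|K|%:R) / 2.
  by field.
rewrite ler_pM2r ?invr_gt0 // ler_pM2l // => main.
apply: (@le_trans _ _ ((3 + 2 * r) * #|K|%:R)); first lra.
rewrite ler_wpM2l ?ler_nat //; first lra.
exact: leq_trans leK (MM_sub (cross_sub side H)).
Qed.

End Bipartition.

(** * Concentration of the degrees in the parts *)

Section Sampling.
Variables (V : finType) (R : realType) (k : nat) (G : {set {set V}}).
Hypotheses (k0 : (0 < k)%N) (sG : simple_graph G).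
Local Notation edge := {e : {set V} | e \in G}.
Implicit Types (H S : {set {set V}}) (f : kassign k G) (i : 'I_k) (v : V).

Lemma in_part f i (x : edge) : (val x \in part f i) = (f x == i).
Proof.
apply/imsetP/idP => [[y]|fx]; last by exists x; rewrite ?inE.
by rewrite !inE => fy /val_inj ->.
Qed.

Lemma part_sub f i : part f i \subset G.
Proof. by apply/subsetP => e /imsetP [x _ ->]; apply: valP. Qed.

Lemma part_disjoint f i j : i != j -> [disjoint part f i & part f j].
Proof.
move=> ij; apply/pred0P => e /=; apply/negP => /andP [/imsetP [x]].
rewrite inE => /eqP fx ->; rewrite in_part fx.
by rewrite (negbTE ij).
Qed.

Lemma part_exists f e : e \in G -> exists i, e \in part f i.
Proof.
move=> eG; exists (f (exist _ e eG)).
by rewrite -[X in X \in _]/(val (exist (fun e => e \in G) e eG)) in_part.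
Qed.

Lemma deg_sum_sub S v : S \subset G ->
  deg S v = (\sum_(x : edge) ((val x \in S) && (v \in val x)))%N.
Proof.
move=> sSG; rewrite /deg.
have -> : [set e in S | v \in e] =
    val @: [set x : edge | (val x \in S) && (v \in val x)].
  apply/setP => e; rewrite inE; apply/andP/imsetP => [[eS ve]|[x]].
    by exists (exist _ e (subsetP sSG _ eS)); rewrite ?inE //= eS.
  by rewrite inE => /andP [h1 h2] ->.
rewrite card_imset; last exact: val_inj.
rewrite -sum1_card big_mkcond /=.
by apply: eq_bigr => x _; rewrite inE; case: (_ && _).
Qed.

Lemma deg_sampled H f i v : H \subset G ->
  (deg (H :&: part f i) v)%:R =
  \sum_(x : edge) ((val x \in H) && (v \in val x))%:R * (f x == i)%:R :> R.
Proof.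
move=> sHG; rewrite deg_sum_sub; last by apply: subset_trans sHG; apply: subsetIl.
rewrite natr_sum; apply: eq_bigr => x _.
by rewrite in_setI in_part -natrM mulnb andbAC.
Qed.

Lemma bernoulli_mgf i (th : R) (c : bool) :
  \sum_(t : 'I_k) (expR (th * (c%:R * (t == i)%:R)) / #|'I_k|%:R) <=
  expR (c%:R * ((expR th - 1) / k%:R)).
Proof.
have k0R : (k%:R : R) != 0 by rewrite pnatr_eq0 -lt0n.
apply: le_trans (expR_ge1Dx _); rewrite -mulr_suml card_ord.
rewrite (bigD1 i) //= eqxx mulr1.
under eq_bigr => t ti do rewrite (negbTE ti) !mulr0 expR0.
rewrite sumr_const cardC1 card_ord -subn1 natrB //.
have -> : expR (th * c%:R) = 1 + c%:R * (expR th - 1).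
  by case: c => /=; rewrite ?mulr1 ?mulr0 ?expR0; ring.
by rewrite le_eqVlt; apply/orP; left; apply/eqP; field.
Qed.

Lemma deg_mgf H i v (th : R) : H \subset G ->
  Ex (fun f : {ffun edge -> 'I_k} => expR (th * (deg (H :&: part f i) v)%:R)) <=
  expR ((deg H v)%:R / k%:R * (expR th - 1)).
Proof.
move=> sHG; pose c (x : edge) := (val x \in H) && (v \in val x).
pose X (x : edge) (t : 'I_k) : R := th * ((c x)%:R * (t == i)%:R).
pose m (x : edge) : R := (c x)%:R * ((expR th - 1) / k%:R).
have -> : (deg H v)%:R / k%:R * (expR th - 1) = \sum_x m x.
  by rewrite deg_sum_sub // natr_sum -mulr_suml mulrAC mulrA.
apply: le_trans (@Ex_expR_le R _ _ X m _); last by move=> x; apply: bernoulli_mgf.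
by apply: Ex_le => f; rewrite deg_sampled // mulr_sumr.
Qed.

(** Chernoff with parameter [th], the sign [sg] treating both tails at once; [D] bounds the mean. *)
Lemma deg_sampled_tail H i v (sg D g th : R) : H \subset G -> `|sg| = 1 ->
  (deg H v)%:R <= k%:R * D -> 0 < th -> th <= 1 / 2 ->
  Pr R (fun f : {ffun edge -> 'I_k} =>
    g <= sg * ((deg (H :&: part f i) v)%:R - (deg H v)%:R / k%:R)) <=
  expR (2 * th ^+ 2 * D - th * g).
Proof.
move=> sHG sg1 dD th0 th2.
have kR : 0 < k%:R :> R by rewrite ltr0n.
set p := (deg H v)%:R / k%:R.
have p0 : 0 <= p by rewrite divr_ge0.
have pD : p <= D by rewrite ler_pdivrMr // mulrC.
have sg2 : sg ^+ 2 = 1 by rewrite -[sg ^+ 2]real_normK ?num_real // sg1 expr1n.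
have sgle : sg <= 1 by rewrite -sg1 ler_norm.
pose q f : R := expR (sg * th * (deg (H :&: part f i) v)%:R).
pose c : R := expR (th * g + sg * th * p).
apply: (@le_trans _ _ (Pr R (fun f : {ffun edge -> 'I_k} => c <= q f))).
  apply: Pr_sub => f; rewrite ler_expR -(ler_pM2l th0); lra.
apply: (@le_trans _ _ (Ex (q : {ffun edge -> 'I_k} -> R) / c)).
  by apply: markov => [|f]; [apply: expR_gt0 | apply: expR_ge0].
apply: (@le_trans _ _ (expR (p * (expR (sg * th) - 1)) / c)).
  by rewrite ler_wpM2r ?invr_ge0 ?expR_ge0 // deg_mgf.
rewrite -expRB ler_expR.
have : expR (sg * th) <= 1 + sg * th + 2 * (sg * th) ^+ 2.
  by apply: expR_le_quad; apply: le_trans th2; rewrite -[leRHS]mul1r ler_pM2r.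
rewrite exprMn sg2 mul1r => quad.
have h1 : p * (expR (sg * th) - 1) <= p * (sg * th + 2 * th ^+ 2).
  by apply: ler_wpM2l => //; lra.
have h2 : 2 * th ^+ 2 * p <= 2 * th ^+ 2 * D.
  by apply: ler_wpM2l => //; rewrite mulr_ge0 ?sqr_ge0.
lra.
Qed.

(* For [k] large a plain Chernoff bound is useless against the union over the
   [k] parts; comparing [expR (Z / 2) - 1] instead of [expR (Z / 2)] with its
   mean keeps a factor [1 / k]. *)
Lemma deg_sampled_tail_sparse H i v (g : R) : H \subset G ->
  (deg H v)%:R / k%:R <= 1 / 2 :> R -> 0 < g ->
  Pr R (fun f : {ffun edge -> 'I_k} => g <= (deg (H :&: part f i) v)%:R) <=
  2 * ((deg H v)%:R / k%:R) / (expR (g / 2) - 1).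
Proof.
move=> sHG; set p := (deg H v)%:R / k%:R => p2 g0.
have p0 : 0 <= p by rewrite divr_ge0.
pose q f : R := expR (1 / 2 * (deg (H :&: part f i) v)%:R) - 1.
pose c : R := expR (g / 2) - 1.
have c0 : 0 < c by rewrite subr_gt0 expR_gt1 divr_gt0.
apply: (@le_trans _ _ (Pr R (fun f : {ffun edge -> 'I_k} => c <= q f))).
  apply: Pr_sub => f; rewrite lerD2r ler_expR; lra.
apply: (@le_trans _ _ (Ex (q : {ffun edge -> 'I_k} -> R) / c)).
  apply: markov => // f; rewrite subr_ge0 -[X in X <= _]expR0 ler_expR.
  by rewrite mulr_ge0 // divr_ge0.
rewrite ler_wpM2r ?invr_ge0 ?(ltW c0) //.
have -> : Ex (q : {ffun edge -> 'I_k} -> R) =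
    Ex (fun f : {ffun edge -> 'I_k} => expR (1 / 2 * (deg (H :&: part f i) v)%:R)) - 1.
  rewrite -[X in _ = _ - X](@Pr_total R edge 'I_k) ?card_ord // PrE /Ex -sumrB.
  by apply: eq_bigr => f _; rewrite -mulrBl.
(* Since [expR (1 / 2) <= 2], the mean of [q] is at most [expR p - 1 <= p + 2 p^2 <= 2 p]. *)
have h1 := @deg_mgf H i v (1 / 2) sHG; rewrite -/p in h1.
have h2 : expR (1 / 2) <= 1 + 1 / 2 + 2 * (1 / 2) ^+ 2 :> R by apply: expR_le_quad.
have h3 : p * (expR (1 / 2) - 1) <= p.
  by rewrite -[leRHS]mulr1; apply: ler_wpM2l => //; lra.
have h4 : expR (p * (expR (1 / 2) - 1)) <= expR p by rewrite ler_expR.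
have h5 : expR p <= 1 + p + 2 * p ^+ 2 by apply: expR_le_quad.
have h6 : p ^+ 2 <= p * (1 / 2) by rewrite expr2; apply: ler_wpM2l.
lra.
Qed.

(** A union bound over vertices, parts and signs. For [k <= 2 #|V|] there are at most [4 #|V|^2]
    events. For larger [k] all means are at most 1/2, the lower tails are empty, and each of the
    [#|V| k] upper tails has probability at most [4 (#|V| / k) expR (- y)]. *)
Lemma sampled_degrees H (D g th y : R) : H \subset G ->
  (forall v, (deg H v)%:R <= k%:R * D) ->
  0 < th -> th <= 1 / 2 -> 2 * th ^+ 2 * D - th * g <= - y -> y <= g / 2 -> 1 <= y ->
  Pr R (fun f : {ffun edge -> 'I_k} => [exists j : V * 'I_k,
    g <= `|(deg (H :&: part f j.2) j.1)%:R - (deg H j.1)%:R / k%:R|]) <=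
  4 * #|V|%:R ^+ 2 * expR (- y).
Proof.
move=> sHG dD th0 th2 hy yg y1.
have sH := simple_graphS sHG sG.
have kR : 0 < k%:R :> R by rewrite ltr0n.
pose Z (v : V) (i : 'I_k) (f : {ffun edge -> 'I_k}) : R :=
  (deg (H :&: part f i) v)%:R - (deg H v)%:R / k%:R.
pose B (j : V * 'I_k * bool) (f : {ffun edge -> 'I_k}) :=
  g <= (-1) ^+ j.2 * Z j.1.1 j.1.2 f.
apply: (@le_trans _ _ (Pr R (fun f => [exists j, B j f]))).
  apply: Pr_sub => f /existsP [[v i]] /= h; apply/existsP.
  exists (v, i, Z v i f < 0); rewrite /B /=.
  move: h; rewrite -/(Z v i f); case: ltrP => h.
    by rewrite ltr0_norm // expr1 mulN1r.
  by rewrite ger0_norm // expr0 mul1r.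
apply: (le_trans (@Pr_union R _ _ _ B)).
have e0 := expR_ge0 (- y).
have [kn|nk] := leqP k (2 * #|V|)%N.
  apply: (@le_trans _ _ (\sum_(j : V * 'I_k * bool) expR (- y))).
    apply: ler_sum => -[[v i] t] _; rewrite /B /Z /=.
    apply: le_trans (deg_sampled_tail i g sHG _ (dD v) th0 th2) _.
      by rewrite normr_sign.
    by rewrite ler_expR.
  rewrite sumr_const !card_prod card_bool card_ord -[_ *+ _]mulr_natl.
  apply: ler_wpM2r => //; rewrite -natrX -natrM ler_nat; nia.
have n0 : 0 <= #|V|%:R :> R by [].
have p2 v : (deg H v)%:R / k%:R <= #|V|%:R / k%:R :> R.
  by rewrite ler_pM2r ?invr_gt0 // ler_nat deg_le_card.
have nk2 : #|V|%:R / k%:R <= 1 / 2 :> R.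
  rewrite ler_pdivrMr //; have : (2 * #|V|)%N%:R <= k%:R :> R by rewrite ler_nat ltnW.
  rewrite natrM; lra.
(* From [1 <= y] follows [2 <= expR y], which absorbs the 1. *)
have ey : expR y / 2 <= expR (g / 2) - 1.
  have h1 : expR y <= expR (g / 2) by rewrite ler_expR.
  have h2 := expR_ge1Dx y; lra.
have bd (j : V * 'I_k * bool) : Pr R (B j) <=
    (~~ j.2)%:R * (4 * (#|V|%:R / k%:R) * expR (- y)).
  case: j => [[v i] [|]] /=.
    rewrite mul0r /Pr big1 // => f; rewrite /B /Z /= expr1 mulN1r => h.
    have : 0 <= (deg (H :&: part f i) v)%:R :> R by [].
    by have := p2 v; lra.
  rewrite mul1r.
  apply: (@le_trans _ _ (Pr R (fun f : {ffun edge -> 'I_k} =>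
     g <= (deg (H :&: part f i) v)%:R))).
    apply: Pr_sub => f; rewrite /B /Z /= expr0 mul1r => /le_trans; apply.
    by rewrite gerBl divr_ge0.
  apply: le_trans (deg_sampled_tail_sparse _ sHG (le_trans (p2 v) nk2) _) _.
    lra.
  rewrite ler_pdivrMr; last by have := expR_gt0 y; lra.
  apply: (@le_trans _ _ (4 * (#|V|%:R / k%:R) * expR (- y) * (expR y / 2))).
    have -> : 4 * (#|V|%:R / k%:R) * expR (- y) * (expR y / 2) =
        2 * (#|V|%:R / k%:R) * (expR y * expR (- y)) by field; rewrite gt_eqF.
    by rewrite expRxMexpNx_1 mulr1 ler_pM2l.
  by apply: ler_wpM2l => //; rewrite !mulr_ge0 // invr_ge0.
apply: (le_trans (ler_sum _ (fun j _ => bd j))).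
rewrite -mulr_suml.
have -> : \sum_(j : V * 'I_k * bool) (~~ j.2)%:R = #|V|%:R * k%:R :> R.
  rewrite -(pair_bigA _ (fun (_ : V * 'I_k) (t : bool) => (~~ t)%:R : R)) /=.
  under eq_bigr do rewrite big_bool /= add0r.
  by rewrite sumr_const card_prod card_ord natrM.
by rewrite le_eqVlt; apply/orP; left; apply/eqP; field; rewrite gt_eqF.
Qed.

End Sampling.

(** * The union of the coresets of the parts *)

Lemma Pr_kpartitionE (R : realType) (V : finType) (k : nat) (G : {set {set V}})
    (A : pred (kassign k G)) : Pr_kpartition R A = Pr R A.
Proof. by rewrite /Pr card_ord. Qed.

(** Both [H :&: part f i] and [C i] are EDCSs of the part with slack [E], so [deg (C i)] is within
    [D] of [deg H / k]. Hence the [C i] differ by at most [2 D] at a vertex, and an edge degree in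
    the union is [k] times that in any one [C i], up to [4 k D]. *)
Lemma union_edcs (V : finType) (R : realType) (k : nat) (G H : {set {set V}})
    (f : kassign k G) (C : 'I_k -> {set {set V}}) (b E h D : R) (J : nat) :
  (0 < k)%N -> simple_graph G -> 0 < b -> 2 <= E -> 0 < h ->
  2 * #|V|%:R ^+ 2 * expR (- (J%:R * (h / (b + E)))) < 1 ->
  edcs (k%:R * b + 1) (k%:R * b - 1) G H ->
  (forall v i,
     `|(deg (H :&: part f i) v)%:R - (deg H v)%:R / k%:R| <= E / 4 :> R) ->
  (forall i, edcs b (b - E) (part f i) (C i)) ->
  D = h + J%:R * (2 * E) + E / 4 ->
  edcs (k%:R * (b + 4 * D)) (k%:R * (b - E - 4 * D)) G (\bigcup_i C i).
Proof.
move=> k0 sG b0 E2 h0 small /edcsP [sHG H1 H2] samp eC DE.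
have kR : 0 < k%:R :> R by rewrite ltr0n.
have k1 : k%:R^-1 <= 1 :> R by rewrite invf_le1 // ler1n.
have sPart i : simple_graph (part f i) := simple_graphS (part_sub f i) sG.
(* Two sampling errors take [E / 2]; the slack of [H] takes [1 / k <= 1 <= E / 2]. *)
have eB i : edcs (b + E) (b - E) (part f i) (H :&: part f i).
  have kb : (k%:R * b + 1) / k%:R = b + k%:R^-1 by field; rewrite gt_eqF.
  have kb' : (k%:R * b - 1) / k%:R = b - k%:R^-1 by field; rewrite gt_eqF.
  apply/edcsP; split; first exact: subsetIr.
    move=> u v; rewrite inE => /andP [/H1 uvH _].
    have : ((deg H u)%:R + (deg H v)%:R) / k%:R <= b + k%:R^-1 :> R.
      by rewrite -kb ler_pM2r // invr_gt0.
    rewrite mulrDl; have := samp u i; have := samp v i.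
    rewrite !ler_norml => /andP [_ s1] /andP [_ s2]; lra.
  move=> u v uvP; rewrite inE uvP andbT => uvH.
  have : b - k%:R^-1 <= ((deg H u)%:R + (deg H v)%:R) / k%:R :> R.
    by rewrite -kb' ler_pM2r ?invr_gt0 // H2 // (subsetP (part_sub f i)).
  rewrite mulrDl; have := samp u i; have := samp v i.
  rewrite !ler_norml => /andP [s1 _] /andP [s2 _]; lra.
have eC' i : edcs (b + E) (b - E) (part f i) (C i).
  by apply: edcs_weak (eC i); lra.
have E0 : 0 <= E by lra.
have gap v i : `|(deg (C i) v)%:R - (deg H v)%:R / k%:R| <= D :> R.
  have g1 := edcs_degree_gap_le v (sPart i) (eC' i) (eB i) b0 E0 h0 small.
  have g2 := edcs_degree_gap_le v (sPart i) (eB i) (eC' i) b0 E0 h0 small.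
  have := samp v i; rewrite !ler_norml DE => /andP [s1 s2].
  by apply/andP; split; lra.
have sC i : C i \subset part f i by have /edcsP [] := eC i.
have disj i j : i != j -> [disjoint C i & C j].
  move=> /(part_disjoint f); apply: disjointW; exact: sC.
have gapU v i : k%:R * ((deg (C i) v)%:R - 2 * D) <= (deg (\bigcup_i C i) v)%:R :> R
    /\ (deg (\bigcup_i C i) v)%:R <= k%:R * ((deg (C i) v)%:R + 2 * D) :> R.
  have near j : (deg (C i) v)%:R - 2 * D <= (deg (C j) v)%:R :> R /\
      (deg (C j) v)%:R <= (deg (C i) v)%:R + 2 * D :> R.
    have := gap v i; have := gap v j; rewrite !ler_norml.
    by move=> /andP [s1 s2] /andP [s3 s4]; split; lra.
  have cst (x : R) : k%:R * x = \sum_(j < k) x.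
    by rewrite sumr_const card_ord mulr_natl.
  rewrite deg_bigcup // natr_sum !cst; split; apply: ler_sum => j _;
    by have [] := near j.
apply/edcsP; split.
- apply/bigcupsP => i _; exact: subset_trans (sC i) (part_sub f i).
- move=> u v /bigcupP [i _ uvC]; have /edcsP [_ C1 _] := eC i.
  have [_ gu] := gapU u i; have [_ gv] := gapU v i.
  apply: (le_trans (lerD gu gv)); rewrite -mulrDr ler_pM2l //.
  have := C1 _ _ uvC; lra.
- move=> u v uvG uvU; have [i uvP] := part_exists f uvG.
  have uvC : [set u; v] \notin C i.
    by apply: contra uvU => uvC; apply/bigcupP; exists i.
  have /edcsP [_ _ C2] := eC i; have := C2 _ _ uvP uvC.
  have [gu _] := gapU u i; have [gv _] := gapU v i => h2.
  apply: le_trans (lerD gu gv); rewrite -mulrDr ler_pM2l //; lra.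
Qed.

(** * Choice of parameters and failure probability *)

Lemma simple_graph_card_le1 (V : finType) (G : {set {set V}}) :
  (#|V| <= 1)%N -> simple_graph G -> G = set0.
Proof.
move=> V1 /forall_inP sG; apply/setP => e; rewrite inE; apply/negP => /sG /eqP e2.
by have := max_card e; rewrite e2 leqNgt ltnS V1.
Qed.

Lemma ln_nat_ge (R : realType) (n : nat) : (1 < n)%N -> 1 / 2 <= ln n%:R :> R.
Proof.
move=> n1; rewrite -[X in X <= _]expRK ler_ln ?posrE ?expR_gt0 ?ltr0n ?(ltnW n1) //.
have h : expR (1 / 2) <= 1 + 1 / 2 + 2 * (1 / 2) ^+ 2 :> R by apply: expR_le_quad.
have : 2 <= n%:R :> R by rewrite ler_nat.
lra.
Qed.

(** Here [lam * b] is the slack in one part and [lam ^+ 2 * b / 256] the Chernoff exponent for a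
    degree deviation of [lam * b / 4]. *)
Lemma edcs_parameters (R : realType) (eps lam L b c : R) :
  0 < eps -> eps < 1 -> 0 < lam -> lam * 512 <= eps ^+ 2 -> 1 / 2 <= L -> 0 <= c ->
  (c + 4) * L <= lam ^+ 2 * b / 256 ->
  [/\ lam <= eps / 64, 0 < b, 2 <= lam * b, lam * b <= b &
      4 * L <= lam ^+ 2 * b / 256 <= lam * b / 4 / 2].
Proof.
move=> eps0 eps1 lam0 lam1 L2 c0 y_ge.
have epsle : eps ^+ 2 <= eps by rewrite expr2 -[leRHS]mul1r ler_pM2r // ltW.
have y4 : 4 * L <= lam ^+ 2 * b / 256.
  by apply: le_trans y_ge; rewrite ler_wpM2r //; lra.
have b0 : 0 < b.
  have : 0 < lam ^+ 2 * b by lra.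
  by rewrite pmulr_rgt0 // exprn_gt0.
have E0 : 0 < lam * b by apply: mulr_gt0.
have lamE : lam ^+ 2 * b <= lam * b.
  by rewrite expr2 -mulrA -[leRHS]mul1r ler_pM2r //; lra.
have bE : lam * b <= b by rewrite -[leRHS]mul1r ler_pM2r //; lra.
split=> //; [lra | lra | rewrite y4; lra].
Qed.

(** With [h] a small fraction of [eps b], a number [J] of steps of order [L / eps] beats [3 L]. The
    drift is of order [lam b L / eps], which [lam L = O(eps^2)] keeps at [O(eps b)]. *)
Lemma gap_budget (R : realType) (eps lam L b : R) :
  0 < eps -> eps < 1 -> 0 < lam -> 1 / 2 <= L -> 0 < b -> lam * b <= b ->
  lam * 512 <= eps ^+ 2 -> lam * L * 512 * 256 <= eps ^+ 2 ->
  exists h, exists J : nat, [/\ 0 < h, 3 * L < J%:R * (h / (b + lam * b)) &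
    4 * (h + J%:R * (2 * (lam * b)) + lam * b / 4) + lam * b <= eps / 8 * b].
Proof.
move=> eps0 eps1 lam0 L2 b0 bE lam1 lamL.
have E0 : 0 < lam * b by apply: mulr_gt0.
have q0 : 0 <= 768 * L / eps by rewrite divr_ge0 ?mulr_ge0 ?(ltW eps0) //; lra.
(* As [b + lam * b <= 2 * b], each step gains at least [eps / 256], and [768 = 3 * 256]. *)
exists (eps * b / 128), (Num.truncn (768 * L / eps)).+1.
set J : R := (Num.truncn _).+1%:R.
have [J1 J2] : J <= 768 * L / eps + 1 /\ 768 * L / eps < J.
  have /andP [t1 t2] := Num.Theory.truncn_itv q0; split=> //.
  by rewrite /J -(natr1 (Num.truncn _)) lerD2r.
move: J J1 J2 => J J1 J2; split.
- by rewrite divr_gt0 // mulr_gt0.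
- have hb : eps / 256 <= eps * b / 128 / (b + lam * b).
    rewrite ler_pdivlMr; last by rewrite addr_gt0.
    have : eps / 256 * (b + lam * b) <= eps / 256 * (2 * b).
      by apply: ler_wpM2l; [rewrite divr_ge0 // ltW | lra].
    lra.
  have J0 : 0 <= J by lra.
  apply: (@lt_le_trans _ _ (J * (eps / 256))); last by apply: ler_wpM2l.
  have : 768 * L / eps * eps < J * eps by rewrite ltr_pM2r.
  rewrite divfK ?gt_eqF //; lra.
- have JE : J * (lam * b) <= (768 * L / eps + 1) * (lam * b) by rewrite ler_pM2r.
  have : 768 * L / eps * lam * 512 * 256 <= 768 * eps.
    have -> : 768 * L / eps * lam * 512 * 256 = 768 * (lam * L * 512 * 256 / eps).
      by field; rewrite gt_eqF.
    by rewrite ler_pM2l // ler_pdivrMr // -expr2.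
  rewrite -(ler_pM2r b0) => LE.
  have epsle : eps ^+ 2 <= eps by rewrite expr2 -[leRHS]mul1r ler_pM2r // ltW.
  have lE : lam * 512 * b <= eps * b.
    by rewrite ler_pM2r // (le_trans lam1).
  clear - JE LE lE E0; lra.
Qed.

(** The deterministic half: once the degrees of [H] are well sampled, any choice of the [C i] has as
    union an EDCS of relative slack [eps / 8], and [edcs_MM_le] applies. *)
Lemma good_partition_matching (R : realType) (V : finType) (k d : nat)
    (G : {set {set V}})
    (eps lam b : R)
    (H : {set {set V}}) (f : kassign k G)
    (C : 'I_k -> {set {set V}}) :
  (0 < k)%N -> (1 < #|V|)%N -> simple_graph G -> 0 < eps -> eps < 1 -> 0 < lam ->
  lam * 512 <= eps ^+ 2 -> lam * ln #|V|%:R * 512 * 256 <= eps ^+ 2 ->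
  (d%:R + 4) * ln #|V|%:R <= lam ^+ 2 * b / 256 ->
  edcs (k%:R * b + 1) (k%:R * b - 1) G H ->
  (forall v i,
     `|(deg (H :&: part f i) v)%:R - (deg H v)%:R / k%:R| <= lam * b / 4 :> R) ->
  (forall i, edcs b ((1 - lam) * b) (part f i) (C i)) ->
  (MM G)%:R / (3 / 2 + eps) <= (MM (\bigcup_i C i))%:R :> R.
Proof.
move=> k0 n1 sG eps0 eps1 lam0 lam1 lamL y_ge.
set n : R := #|V|%:R in lamL y_ge *.
have L2 : 1 / 2 <= ln n by apply: ln_nat_ge.
have n2 : 2 <= n by rewrite ler_nat.
have nL : n = expR (ln n) by rewrite lnK // posrE ltr0n ltnW.
have [lam64 b0 E2 bE /andP [y4 yg]] :=
  edcs_parameters eps0 eps1 lam0 lam1 L2 (ler0n _ d) y_ge.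
move=> eH samp eC.
have [h [J [h0 J3 DE]]] := gap_budget eps0 eps1 lam0 L2 b0 bE lam1 lamL.
have small : 2 * n ^+ 2 * expR (- (J%:R * (h / (b + lam * b)))) < 1.
  apply: (@le_lt_trans _ _ (n ^+ 3 * expR (- (J%:R * (h / (b + lam * b)))))).
    by rewrite ler_wpM2r ?expR_ge0 // [n ^+ 3]exprS ler_wpM2r ?sqr_ge0.
  by rewrite {1}nL -expRM_natl -expRD expR_lt1 subr_lt0.
have kR : 1 <= k%:R :> R by rewrite ler1n.
have kR0 : 0 < k%:R :> R by rewrite ltr0n.
have kb0 : 0 < k%:R * b by rewrite mulr_gt0.
have eU : edcs ((1 + eps / 8) * (k%:R * b)) ((1 - eps / 8) * (k%:R * b)) G
    (\bigcup_i C i).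
  set D := h + _ + _ in DE.
  apply: (@edcs_weak V R (k%:R * (b + 4 * D)) _ (k%:R * (b - lam * b - 4 * D))).
  - rewrite mulrCA ler_pM2l //; clear - DE E2; lra.
  - rewrite mulrCA ler_pM2l //; clear - DE E2; lra.
  - apply: (union_edcs k0 sG b0 E2 h0 small eH samp _ erefl) => i.
    by have := eC i; rewrite mulrBl mul1r.
have eps4 : 0 < 2 * (1 - 2 * (eps / 8)) by clear - eps1; lra.
have : 2 * (1 - 2 * (eps / 8)) * (MM G)%:R <=
    (3 + 2 * (eps / 8)) * (MM (\bigcup_i C i))%:R.
  apply: (edcs_MM_le sG kb0) eU; [by rewrite divr_gt0 | by clear - eps1; lra |].
  have yle : lam ^+ 2 * b / 256 <= (eps / 8) ^+ 2 * (k%:R * b) / 64.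
    have l2 : lam ^+ 2 <= (eps / 8) ^+ 2 / 64.
      have -> : (eps / 8) ^+ 2 / 64 = (eps / 64) ^+ 2 by field.
      by rewrite ler_pXn2r ?nnegrE ?divr_ge0 // ltW.
    have h1 : lam ^+ 2 * b <= (eps / 8) ^+ 2 / 64 * b by rewrite ler_pM2r.
    have h2 : b <= k%:R * b by rewrite -[leLHS]mul1r ler_pM2r.
    have h3 : (eps / 8) ^+ 2 / 64 * b <= (eps / 8) ^+ 2 / 64 * (k%:R * b).
      by apply: ler_wpM2l => //; rewrite divr_ge0 // sqr_ge0.
    have h4 : 0 <= lam ^+ 2 * b by rewrite mulr_ge0 ?sqr_ge0 // ltW.
    clear - h1 h3 h4; lra.
  apply: (@le_lt_trans _ _ (n ^+ 2 * expR (- ((eps / 8) ^+ 2 * (k%:R * b) / 64)))).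
    by rewrite ler_wpM2r ?expR_ge0 // expr2 ler_wpM2r.
  rewrite {1}nL -expRM_natl -expRD expR_lt1; clear - yle y4 L2; lra.
rewrite ler_pdivrMr; last by rewrite addr_gt0 // divr_gt0.
set m := (MM G)%:R; set c := (MM _)%:R => hmc.
have c0 : 0 <= c by [].
rewrite -(ler_pM2l eps4); apply: le_trans hmc _.
(* The margin is [(3 / 2 + eps) (2 - eps / 2) - (3 + eps / 4) = eps - eps^2 / 2]. *)
have e0 : 0 <= eps * c by rewrite mulr_ge0 // ltW.
have e1 : eps * c * eps <= eps * c by rewrite ler_piMr // ltW.
clear - c0 e0 e1; lra.
Qed.

(** As [H] is fixed before the partition is drawn, one event about its sampled degrees handles all
    adversarial outputs at once. *)
Lemma coreset_bound (R : realType) (V : finType) (k d : nat) (G : {set {set V}})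
    (eps lam b : R) :
  (0 < k)%N -> (1 < #|V|)%N -> simple_graph G -> 0 < eps -> eps < 1 -> 0 < lam ->
  lam * 512 <= eps ^+ 2 -> lam * ln #|V|%:R * 512 * 256 <= eps ^+ 2 ->
  (d%:R + 4) * ln #|V|%:R <= lam ^+ 2 * b / 256 ->
  1 - #|V|%:R ^- d <=
  Pr_kpartition R (fun f : kassign k G =>
    [forall C : {ffun 'I_k -> {set {set V}}},
       [forall i, edcs b ((1 - lam) * b) (part f i) (C i)] ==>
       ((MM G)%:R / (3 / 2 + eps) <= (MM (\bigcup_i C i))%:R :> R)]).
Proof.
move=> k0 n1 sG eps0 eps1 lam0 lam1 lamL y_ge.
set n : R := #|V|%:R in lamL y_ge *.
have L2 : 1 / 2 <= ln n by apply: ln_nat_ge.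
have n2 : 2 <= n by rewrite ler_nat.
have nL : n = expR (ln n) by rewrite lnK // posrE ltr0n ltnW.
have [lam64 b0 E2 bE /andP [y4 yg]] :=
  edcs_parameters eps0 eps1 lam0 lam1 L2 (ler0n _ d) y_ge.
have [H eH] := @edcs_exists V R (k%:R * b) G sG.
have /edcsP [sHG _ _] := eH.
have kR : 1 <= k%:R :> R by rewrite ler1n.
have kb : 1 <= k%:R * b.
  by rewrite -[leLHS]mulr1; apply: ler_pM => //; clear - E2 bE; lra.
have dH v : (deg H v)%:R <= k%:R * (2 * b).
  by apply: le_trans (edcs_deg_le v sG _ eH) _; clear - kb; lra.
set y := lam ^+ 2 * b / 256 in y4 yg.
pose bad (f : {ffun {e : {set V} | e \in G} -> 'I_k}) := [exists j : V * 'I_k,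
  lam * b / 4 <= `|(deg (H :&: part f j.2) j.1)%:R - (deg H j.1)%:R / k%:R|].
have badP : Pr R bad <= 4 * n ^+ 2 * expR (- y).
  (* The choice [lam / 32] minimises [2 th^2 (2 b) - th lam b / 4], with value [- y]. *)
  apply: (@sampled_degrees V R k G k0 sG H (2 * b) (lam * b / 4) (lam / 32)) => //.
  - by rewrite divr_gt0.
  - by clear - lam64 eps1; lra.
  - by rewrite (_ : _ - _ = - y) // /y; field.
  - by have := L2; clear - y4; lra.
have badP' : 4 * n ^+ 2 * expR (- y) <= n ^- d.
  have -> : n ^- d = expR (- (d%:R * ln n)) by rewrite expRN expRM_natl -nL.
  (* The factor 4 is at most [n^2], and [(d + 4) ln n <= y] turns [n^4] into [n^-d]. *)
  apply: (@le_trans _ _ (n ^+ 4 * expR (- y))).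
    rewrite ler_wpM2r ?expR_ge0 //.
    have -> : n ^+ 4 = n ^+ 2 * n ^+ 2 by ring.
    rewrite ler_wpM2r ?sqr_ge0 // expr2.
    have : 2 * 2 <= n * n by apply: ler_pM.
    by rewrite -natrM.
  rewrite {1}nL -expRM_natl -expRD ler_expR.
  move: y_ge; rewrite -/y; clear; lra.
rewrite Pr_kpartitionE.
apply: (@le_trans _ _ (Pr R (predC bad))).
  have := @PrC R {e : {set V} | e \in G} 'I_k _ (predC bad).
  rewrite card_ord => /(_ k0) ->; rewrite lerD2l lerN2.
  apply: le_trans badP'; apply: le_trans badP; apply: Pr_sub => f.
  by rewrite /= negbK.
apply: Pr_sub => f /existsPn good; apply/forallP => C; apply/implyP => /forallP eC.
apply: (good_partition_matching k0 n1 sG eps0 eps1 lam0 lam1 lamL y_ge eH) => // v i.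
by have := good (v, i); rewrite -ltNge => /ltW.
Qed.

Theorem theorem5p2 (R : realType) (d : nat) :
  exists cl cb cs : R, [/\ 0 < cl, 0 < cb, 0 < cs &
    forall (V : finType) (k : nat) (eps : R),
      (1 <= k)%N -> 0 < eps < 1 ->
      let n : R := #|V|%:R in
      let lambda := cl * (eps / ln n) ^+ 2 in
      let beta := cb * eps ^- 6 * ln n ^+ 7 in
      let ALG : rel {set {set V}} := edcs beta ((1 - lambda) * beta) in
      randomized_composable_coreset k (3 / 2 + eps) (n ^- d) ALG /\
      coreset_size_le ALG (cs * (n * beta))].
Proof.
(* With [cl], [lam * L ^+ 2] is [eps^2 / 512^2]. Dividing by [cl ^+ 2] in [cb] makes [lam ^+ 2 * b]
   equal to [1024 (d + 4) eps^-2 L^3], where 1024 is the 256 of the exponent times the 4 of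
   [L / 4 <= L ^+ 3]. Only [cb] depends on [d]. *)
pose cl : R := (512 * 512)^-1.
pose cb : R := 1024 * (d%:R + 4) / cl ^+ 2.
have c512 : 0 < 512 * 512 :> R by rewrite mulr_gt0.
have cl0 : 0 < cl by rewrite invr_gt0.
have clE : cl * 512 * 512 = 1 by rewrite -mulrA mulVf // gt_eqF.
have cb0 : 0 < cb by rewrite divr_gt0 ?exprn_gt0 // mulr_gt0 // ltr_wpDl.
have cbE : cl ^+ 2 * cb = 1024 * (d%:R + 4).
  by rewrite /cb mulrC divfK // gt_eqF // exprn_gt0.
exists cl, cb, 1; split=> // V k eps k0 /andP [eps0 eps1] n lam b ALG.
have ALG_sub G C : ALG G C -> C \subset G by case/edcsP.
(* Here [ln n = 0], also for [n = 0] by convention, so [beta] degenerates to 0; but the only simple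
   graph is the empty one. *)
have [n1|n1] := leqP #|V| 1.
  have simple0 (G : {set {set V}}) : simple_graph G -> G = set0.
    exact: simple_graph_card_le1.
  split; last first.
    move=> G C /simple0 -> /ALG_sub; rewrite subset0 => /eqP ->.
    rewrite cards0 mul1r mulr_ge0 // mulr_ge0 ?exprn_ge0 //; last first.
      by have := n1; rewrite /n; case: #|V| => [|[|]] // _; rewrite ?ln1 // ln0.
    by rewrite mulr_ge0 ?invr_ge0 ?exprn_ge0 // ltW.
  split=> [G /simple0 ->|G C _ /ALG_sub //|G /simple0 G0].
    by exists set0; apply/edcsP; split=> // u v; rewrite inE.
  apply: (@le_trans _ _ 1); first by rewrite gerBl invr_ge0 exprn_ge0.
  have MM0 : MM G = 0%N.
    have [M /andP [sM _] <-] := MM_witness G.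
    by apply/eqP; rewrite cards_eq0 -subset0 -G0.
  rewrite Pr_kpartitionE -[leLHS](@Pr_total R {e : {set V} | e \in G} 'I_k); last first.
    by rewrite card_ord.
  apply: Pr_sub => f _; apply/forallP => C; apply/implyP => _.
  by rewrite MM0 mul0r.
have L2 : 1 / 2 <= ln n by apply: ln_nat_ge.
set L := ln n in lam b ALG L2 ALG_sub *.
have L0 : 0 < L by lra.
have Lpow j : (1 / 2) ^+ j <= L ^+ j by rewrite lerXn2r ?nnegrE //; lra.
have lam0 : 0 < lam by rewrite /lam mulr_gt0 // exprn_gt0 // divr_gt0.
have b0 : 0 < b.
  apply: mulr_gt0; last exact: exprn_gt0.
  by apply: mulr_gt0 => //; rewrite invr_gt0 exprn_gt0.
have lamE : lam * L ^+ 2 = cl * eps ^+ 2.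
  by rewrite /lam expr_div_n -mulrA divfK // gt_eqF // exprn_gt0.
have y_ge : (d%:R + 4) * L <= lam ^+ 2 * b / 256.
  have -> : lam ^+ 2 * b / 256 = (cl ^+ 2 * cb) * (eps ^- 2 * L ^+ 3) / 256.
    by rewrite /lam /b; field; rewrite !gt_eqF.
  rewrite cbE.
  have h1 : 1 <= eps ^- 2.
    by rewrite invf_ge1 ?exprn_gt0 // exprn_ile1 ?ltW.
  have h2 : L / 4 <= L ^+ 3.
    have := Lpow 2; rewrite exprS => h; rewrite -[leLHS]mulrC mulrC.
    by rewrite ler_pM2l //; lra.
  have h3 : L / 4 <= eps ^- 2 * L ^+ 3.
    by rewrite -[leLHS]mul1r; apply: ler_pM => //; lra.
  have h4 : 1024 * (d%:R + 4) * (L / 4) <= 1024 * (d%:R + 4) * (eps ^- 2 * L ^+ 3).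
    by apply: ler_wpM2l => //; rewrite mulr_ge0 // addr_ge0.
  lra.
have clE' : cl * eps ^+ 2 * 512 * 512 = eps ^+ 2.
  by rewrite [cl * _]mulrC -!mulrA [cl * _]mulrA clE mulr1.
have lam512 : lam * 512 <= eps ^+ 2.
  have : lam * (1 / 2) ^+ 2 <= lam * L ^+ 2 by rewrite ler_pM2l.
  have : 0 <= cl * eps ^+ 2 by rewrite mulr_ge0 ?sqr_ge0 // ltW.
  lra.
have lamL : lam * L * 512 * 256 <= eps ^+ 2.
  have : lam * L * (1 / 2) <= lam * L * L by rewrite ler_pM2l // mulr_gt0.
  rewrite -[lam * L * L]mulrA -expr2 lamE; lra.
split; last first.
  move=> G C sG aC; rewrite mul1r.
  have sC := simple_graphS (ALG_sub _ _ aC) sG.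
  apply: (@le_trans _ _ (\sum_v (deg C v)%:R)).
    by rewrite -natr_sum ler_nat card_le_sum_deg.
  rewrite /n mulr_natl -sumr_const; apply: ler_sum => v _.
  exact: edcs_deg_le sG (ltW b0) aC.
split=> [G sG|G C _ /ALG_sub //|G sG].
  (* This gives the bounds [b] and [b - 2], and [2 <= lam * b] weakens the latter to
     [(1 - lam) * b]. *)
  have [C eC] := @edcs_exists V R (b - 1) G sG; exists C.
  apply: edcs_weak eC; first lra.
  have [_ _ E2 _ _] := edcs_parameters eps0 eps1 lam0 lam512 L2 (ler0n _ d) y_ge.
  clear - E2; lra.
exact: coreset_bound.
Qed.
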